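(* Let $X$ be a compact metric space, $r>0$, and let $\mathcal{U}$ be a good open cover of $X$ such that for every finite subset $\sigma\subset X$: $\sigma$ is contained in some element of $\mathcal{U}$ iff $\operatorname{Diam}(\sigma)<r$. Then there exists a countable subset $C\subset X$ such that $\operatorname{Rips}(C,r)\simeq X$.
   Context: For $A\subset X$, $\operatorname{Rips}(A,r)$ is the simplicial complex (weak topology) with vertex set $A$ whose simplices are the finite subsets of $A$ of diameter $<r$. A cover is good if every finite intersection of its members is empty or contractible. *)

(* Defs.v *)
From Stdlib Require Import Reals List.
Open Scope R_scope.
Set Implicit Arguments.

(** Topological spaces (the open-set predicate; axioms are not needed to state the theorem) *)
Record TopSp := { pt : Type; op : (pt -> Prop) -> Prop }.

Definition continuous (A B : TopSp) (f : pt A -> pt B) : Prop :=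
  forall V, op B V -> op A (fun a => V (f a)).

Definition I01 := { s : R | 0 <= s <= 1 }.
Lemma I0_pf : 0 <= 0 <= 1. Proof. split; [apply Rle_refl | apply Rle_0_1]. Qed.
Lemma I1_pf : 0 <= 1 <= 1. Proof. split; [apply Rle_0_1 | apply Rle_refl]. Qed.
Definition I0 : I01 := exist _ 0 I0_pf.
Definition I1 : I01 := exist _ 1 I1_pf.

Definition prodI (A : TopSp) : TopSp :=
  {| pt := (pt A * I01)%type;
     op := fun W => forall p, W p -> exists U eps, op A U /\ U (fst p) /\ 0 < eps /\
             forall a (s : I01), U a -> Rabs (proj1_sig s - proj1_sig (snd p)) < eps -> W (a, s) |}.

Definition homotopic (A B : TopSp) (f g : pt A -> pt B) : Prop :=
  exists H : pt (prodI A) -> pt B, continuous (prodI A) B H /\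
    forall a, H (a, I0) = f a /\ H (a, I1) = g a.

Definition homotopy_equivalent (A B : TopSp) : Prop :=
  exists (f : pt A -> pt B) (g : pt B -> pt A),
    continuous A B f /\ continuous B A g /\
    homotopic A A (fun a => g (f a)) (fun a => a) /\
    homotopic B B (fun b => f (g b)) (fun b => b).

Definition subsp (A : TopSp) (S : pt A -> Prop) : TopSp :=
  {| pt := { a : pt A | S a };
     op := fun V => exists U, op A U /\ forall x, V x <-> U (proj1_sig x) |}.

Definition contractible (A : TopSp) : Prop :=
  exists x0 : pt A, homotopic A A (fun a => a) (fun _ => x0).

Definition is_metric (X : Type) (d : X -> X -> R) : Prop :=
  (forall x y, 0 <= d x y) /\ (forall x y, d x y = 0 <-> x = y) /\
  (forall x y, d x y = d y x) /\ (forall x y z, d x z <= d x y + d y z).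

Definition metric_top (X : Type) (d : X -> X -> R) : TopSp :=
  {| pt := X;
     op := fun U => forall x, U x -> exists eps, 0 < eps /\ forall y, d x y < eps -> U y |}.

Definition compact_metric (X : Type) (d : X -> X -> R) : Prop :=
  forall F : (X -> Prop) -> Prop,
    (forall V, F V -> op (metric_top d) V) ->
    (forall x, exists V, F V /\ V x) ->
    exists l : list (X -> Prop), Forall F l /\ forall x, exists V, In V l /\ V x.

Definition open_cover (X : Type) (d : X -> X -> R) (U : (X -> Prop) -> Prop) : Prop :=
  (forall V, U V -> op (metric_top d) V) /\ (forall x, exists V, U V /\ V x).

Definition inter_list (X : Type) (l : list (X -> Prop)) : X -> Prop :=
  fun x => forall V, In V l -> V x.

Definition good_cover (X : Type) (d : X -> X -> R) (U : (X -> Prop) -> Prop) : Prop :=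
  forall l : list (X -> Prop), l <> nil -> Forall U l ->
    (forall x, ~ inter_list l x) \/ contractible (subsp (metric_top d) (inter_list l)).

Definition diam_lt (X : Type) (d : X -> X -> R) (s : list X) (r : R) : Prop :=
  forall x y, In x s -> In y s -> d x y < r.

Definition countable (X : Type) (C : X -> Prop) : Prop :=
  exists f : { x | C x } -> nat, forall a b, f a = f b -> a = b.

(** Geometric realization of Rips(C, r) with the weak topology.
    A point is a function t : X -> R, nonnegative, summing to 1, supported in
    a simplex (a duplicate-free list of vertices in C of diameter < r). *)
Fixpoint sumR (X : Type) (t : X -> R) (l : list X) : R :=
  match l with nil => 0 | x :: l' => t x + sumR t l' end.

Definition rips_simplex (X : Type) (d : X -> X -> R) (C : X -> Prop) (r : R) (l : list X) : Prop :=
  NoDup l /\ (forall x, In x l -> C x) /\ diam_lt d l r.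

Definition supported (X : Type) (t : X -> R) (l : list X) : Prop :=
  forall x, ~ In x l -> t x = 0.

Definition rips_point (X : Type) (d : X -> X -> R) (C : X -> Prop) (r : R) (t : X -> R) : Prop :=
  (forall x, 0 <= t x) /\
  exists l, rips_simplex d C r l /\ supported t l /\ sumR t l = 1.

(** V is open iff its trace on each closed simplex |l| is open in |l|
    (with the Euclidean, equivalently sup-norm, topology on barycentric coordinates). *)
Definition rips_top (X : Type) (d : X -> X -> R) (C : X -> Prop) (r : R) : TopSp :=
  {| pt := { t : X -> R | rips_point d C r t };
     op := fun V => forall l, rips_simplex d C r l ->
             forall p, V p -> supported (proj1_sig p) l ->
             exists eps, 0 < eps /\ forall q, supported (proj1_sig q) l ->
               (forall x, In x l -> Rabs (proj1_sig q x - proj1_sig p x) < eps) -> V q |}.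

(* Main.v *)
(** The set C may be any countable dense subset.  A map Rips(C, r) -> X is written down without
    induction on cells.  Choose for every finite s a member V s of U containing it (and containing a
    fixed neighbourhood of s if s is small).  A point p of the Rips complex gives weights to simplices
    s by barycentric subdivision, and subdividing these weights again gives a chain S_1 > ... > S_m of
    sets of simplices, with times in [0, 1] at least one of which is 1.  The intersections of the
    V s, s in S_j, are nonempty, contractible and increasing in j; applying their contractions one
    after the other, for these times, to a starting point gives the image of p.  A contraction run for
    time 1 forgets the starting point, and run for time 0 does nothing, so the result is well defined
    and continuous across faces.

    The map X -> Rips(C, r) uses a partition of unity for a finite cover by small balls and picks a
    point of C in each nonempty intersection.  For the composite on X, run all contractions for s times
    their time, starting at x itself: s = 0 gives x and s = 1 the composite.  For the composite on
    Rips(C, r), both it and the identity are connected to maps obtained by picking points of C in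
    intersections of regions V s and small balls, through weights on these regions. *)
Require Import Defs.
From Stdlib Require Import Reals List Lra Lia Permutation Cantor.
From Stdlib Require Import Classical ClassicalEpsilon FunctionalExtensionality PropExtensionality ProofIrrelevance.
From Coquelicot Require Compactness.
Open Scope R_scope.

(** The sets [V s] for the faces [s] of a simplex are chosen independently and need not be nested;
    only their intersections along a chain of sets of faces are. This forces the second subdivision,
    and smaller intersections must be contracted first. The starting point cannot be chosen
    continuously: it is a vertex of maximal weight, which lies in every simplex of positive weight
    but jumps. Dividing the times by their maximum makes one of them 1, so that the jump leaves no
    trace. For the composite on the Rips complex, the image of [p] must lie in the regions of all
    simplices still in use when the small balls enter; truncating the simplex weights at half their
    maximum secures this. Since [C] is dense, the Rips complex is in general not locally finite:
    continuity out of it is tested on closed simplices, and maps into it are kept locally within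
    finitely many vertices. *)

Lemma pred_ext (J : Type) (S T : J -> Prop) : (forall i, S i <-> T i) -> S = T.
Proof.
  intro H. apply functional_extensionality; intro i.
  apply propositional_extensionality, H.
Qed.

Lemma choice_function (A B : Type) (P : A -> B -> Prop) :
  (forall a, exists b, P a b) -> exists f, forall a, P a (f a).
Proof.
  intro H. exists (fun a => proj1_sig (constructive_indefinite_description _ (H a))).
  intro a. apply proj2_sig.
Qed.

Lemma Rabs_le_bounds (x e : R) : Rabs x <= e -> - e <= x <= e.
Proof. unfold Rabs. destruct Rcase_abs; lra. Qed.

(** * Filters and limits *)

(** One notion of limit serves neighbourhoods in [X], neighbourhoods in a closed simplex, their
    products with an interval of times, and restrictions to a closed piece. *)
Record is_filter (Z : Type) (F : (Z -> Prop) -> Prop) : Prop := {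
  filt_true : F (fun _ => True);
  filt_and : forall P Q : Z -> Prop, F P -> F Q -> F (fun z => P z /\ Q z);
  filt_imp : forall P Q : Z -> Prop, (forall z, P z -> Q z) -> F P -> F Q }.

Definition lim (Z : Type) (F : (Z -> Prop) -> Prop) (u : Z -> R) (a : R) : Prop :=
  forall e, 0 < e -> F (fun z => Rabs (u z - a) < e).

(** Gaps and suprema range over all sets of indices, so weights must converge uniformly; the
    non-strict bound survives taking suprema. *)
Definition unif_lim (Z J : Type) (F : (Z -> Prop) -> Prop) (w : Z -> J -> R) (w0 : J -> R) : Prop :=
  forall e, 0 < e -> F (fun z => forall j, Rabs (w z j - w0 j) <= e).

Definition metric_lim (X Z : Type) (d : X -> X -> R) (F : (Z -> Prop) -> Prop)
    (y : Z -> X) (y0 : X) : Prop :=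
  forall e, 0 < e -> F (fun z => d y0 (y z) < e).

Section Limits.
Context (Z : Type) (F : (Z -> Prop) -> Prop) (HF : is_filter Z F).

Lemma filt_all (P : Z -> Prop) : (forall z, P z) -> F P.
Proof. intro H. apply (filt_imp _ _ HF (fun _ => True)); [auto | apply HF]. Qed.

Lemma filt_list (J : Type) (l : list J) (P : J -> Z -> Prop) :
  (forall j, In j l -> F (P j)) -> F (fun z => forall j, In j l -> P j z).
Proof.
  induction l as [|a l IH]; intro H.
  - apply filt_all. intros z j [].
  - eapply (filt_imp _ _ HF).
    2: { apply (filt_and _ _ HF).
         - apply (H a). now left.
         - apply IH. intros j Hj. apply H. now right. }
    cbn. intros z [H1 H2] j [<- | Hj]; auto.
Qed.

Lemma lim_const (a : R) : lim Z F (fun _ => a) a.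
Proof. intros e He. apply filt_all. intros _. rewrite Rminus_diag, Rabs_R0. exact He. Qed.

Lemma lim_ext_loc (u v : Z -> R) (a : R) : F (fun z => u z = v z) -> lim Z F u a -> lim Z F v a.
Proof.
  intros H Hu e He. eapply (filt_imp _ _ HF). 2: exact (filt_and _ _ HF _ _ H (Hu e He)).
  cbn. intros z [E H1]. now rewrite <- E.
Qed.

Lemma lim_plus (u v : Z -> R) (a b : R) :
  lim Z F u a -> lim Z F v b -> lim Z F (fun z => u z + v z) (a + b).
Proof.
  intros Hu Hv e He. assert (He2 : 0 < e / 2) by lra.
  eapply (filt_imp _ _ HF). 2: exact (filt_and _ _ HF _ _ (Hu _ He2) (Hv _ He2)).
  cbn. intros z [H1 H2]. apply Rabs_def2 in H1, H2. apply Rabs_def1; lra.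
Qed.

Lemma lim_lip (u v : Z -> R) (a b k : R) : 0 <= k ->
  (forall z, Rabs (v z - b) <= k * Rabs (u z - a)) -> lim Z F u a -> lim Z F v b.
Proof.
  intros Hk H Hu e He.
  assert (He2 : 0 < e / (k + 1)) by (apply Rdiv_lt_0_compat; lra).
  eapply (filt_imp _ _ HF). 2: exact (Hu _ He2).
  cbn. intros z H1. eapply Rle_lt_trans. { apply H. }
  apply Rle_lt_trans with ((k + 1) * Rabs (u z - a)).
  - generalize (Rabs_pos (u z - a)). intro. nra.
  - apply Rlt_le_trans with ((k + 1) * (e / (k + 1))).
    + apply Rmult_lt_compat_l; lra.
    + right. field. lra.
Qed.

Lemma lim_opp (u : Z -> R) (a : R) : lim Z F u a -> lim Z F (fun z => - u z) (- a).
Proof.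
  apply lim_lip with 1; [lra|]. intro z.
  replace (- u z - - a) with (- (u z - a)) by ring. rewrite Rabs_Ropp. lra.
Qed.

Lemma lim_minus (u v : Z -> R) (a b : R) :
  lim Z F u a -> lim Z F v b -> lim Z F (fun z => u z - v z) (a - b).
Proof. intros Hu Hv. apply lim_plus; [assumption | now apply lim_opp]. Qed.

Lemma lim_Rmax_l (c : R) (u : Z -> R) (a : R) :
  lim Z F u a -> lim Z F (fun z => Rmax c (u z)) (Rmax c a).
Proof.
  apply lim_lip with 1; [lra|]. intro z. unfold Rmax.
  destruct (Rle_dec c (u z)), (Rle_dec c a); unfold Rabs;
    repeat destruct Rcase_abs; lra.
Qed.

Lemma lim_gt (u : Z -> R) (a b : R) : b < a -> lim Z F u a -> F (fun z => b < u z).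
Proof.
  intros H Hu. eapply (filt_imp _ _ HF). 2: exact (Hu (a - b) ltac:(lra)).
  cbn. intros z H1. apply Rabs_def2 in H1. lra.
Qed.

Lemma lim_mult (u v : Z -> R) (a b : R) :
  lim Z F u a -> lim Z F v b -> lim Z F (fun z => u z * v z) (a * b).
Proof.
  intros Hu Hv e He.
  set (M := Rabs a + Rabs b + 1).
  assert (HM : 0 < M) by (unfold M; generalize (Rabs_pos a) (Rabs_pos b); lra).
  assert (He2 : 0 < Rmin 1 (e / (2 * M))).
  { apply Rmin_pos; [lra|]. apply Rdiv_lt_0_compat; lra. }
  eapply (filt_imp _ _ HF). 2: exact (filt_and _ _ HF _ _ (Hu _ He2) (Hv _ He2)).
  cbn. intros z [H1 H2].
  replace (u z * v z - a * b) with ((u z - a) * v z + a * (v z - b)) by ring.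
  eapply Rle_lt_trans. { apply Rabs_triang. } rewrite !Rabs_mult.
  assert (Hv1 : Rabs (v z) <= Rabs b + 1).
  { replace (v z) with (b + (v z - b)) by ring. eapply Rle_trans; [apply Rabs_triang|].
    generalize (Rmin_l 1 (e / (2 * M))); lra. }
  generalize (Rmin_r 1 (e / (2 * M))); intro Hr.
  assert (E : e / (2 * M) * M = e / 2) by (field; lra).
  set (q := e / (2 * M)) in *.
  assert (A1 : Rabs (u z - a) * Rabs (v z) <= q * (Rabs b + 1)).
  { apply Rmult_le_compat; try apply Rabs_pos; lra. }
  assert (A2 : Rabs a * Rabs (v z - b) <= Rabs a * q).
  { apply Rmult_le_compat_l; [apply Rabs_pos | lra]. }
  assert (A3 : q * (Rabs b + 1) + Rabs a * q = e / 2) by (rewrite <- E; unfold M; ring).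
  lra.
Qed.

Lemma lim_inv (u : Z -> R) (a : R) : 0 < a -> lim Z F u a -> lim Z F (fun z => / u z) (/ a).
Proof.
  intros Ha Hu e He.
  assert (He2 : 0 < Rmin (a / 2) (e * (a * a / 2))).
  { apply Rmin_pos; [lra|]. apply Rmult_lt_0_compat; nra. }
  eapply (filt_imp _ _ HF). 2: exact (Hu _ He2).
  cbn. intros z H1.
  generalize (Rmin_l (a / 2) (e * (a * a / 2))) (Rmin_r (a / 2) (e * (a * a / 2))); intros L1 L2.
  assert (Hz : a / 2 < u z).
  { apply Rabs_def2 in H1. lra. }
  replace (/ u z - / a) with (- (u z - a) * / (u z * a)) by (field; lra).
  rewrite Rabs_mult, Rabs_Ropp.
  rewrite (Rabs_pos_eq (/ (u z * a))).
  2: { left. apply Rinv_0_lt_compat. nra. }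
  apply Rmult_lt_reg_r with (u z * a); [nra|].
  rewrite Rmult_assoc, Rinv_l by nra.
  rewrite Rmult_1_r.
  assert (e * (a * a / 2) < e * (u z * a)).
  { apply Rmult_lt_compat_l; [lra|]. nra. }
  lra.
Qed.

Lemma lim_div (u v : Z -> R) (a b : R) : 0 < b ->
  lim Z F u a -> lim Z F v b -> lim Z F (fun z => u z / v z) (a / b).
Proof. intros Hb Hu Hv. apply lim_mult; [assumption | now apply lim_inv]. Qed.

Lemma lim_sumR (X : Type) (l : list X) (u : Z -> X -> R) (u0 : X -> R) :
  (forall x, In x l -> lim Z F (fun z => u z x) (u0 x)) ->
  lim Z F (fun z => sumR (u z) l) (sumR u0 l).
Proof.
  induction l as [|a l IH]; intro H; cbn.
  - apply lim_const.
  - apply lim_plus.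
    + apply H. now left.
    + apply IH. intros x Hx. apply H. now right.
Qed.

Lemma unif_lim_at (J : Type) (w : Z -> J -> R) (w0 : J -> R) (j : J) :
  unif_lim Z J F w w0 -> lim Z F (fun z => w z j) (w0 j).
Proof.
  intros H e He. eapply (filt_imp _ _ HF). 2: exact (H (e / 2) ltac:(lra)).
  cbn. intros z Hz. specialize (Hz j). lra.
Qed.

Lemma unif_lim_lip (I J : Type) (w : Z -> I -> R) (w0 : I -> R)
    (v : Z -> J -> R) (v0 : J -> R) (k : R) : 0 < k ->
  (forall z e, 0 < e -> (forall i, Rabs (w z i - w0 i) <= e) -> forall j, Rabs (v z j - v0 j) <= k * e) ->
  unif_lim Z I F w w0 -> unif_lim Z J F v v0.
Proof.
  intros Hk H Hw e He.
  assert (He2 : 0 < e / k) by (apply Rdiv_lt_0_compat; lra).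
  eapply (filt_imp _ _ HF). 2: exact (Hw _ He2).
  cbn. intros z Hz j. replace e with (k * (e / k)) by (field; lra). now apply H.
Qed.

End Limits.

(** * Suprema and superlevel gaps *)

(** Adjoining 0 gives the empty set supremum 0 and takes a positive part without a case
    distinction. *)
Definition sup0 (E : R -> Prop) : R := epsilon (inhabits 0) (is_lub (fun e => e = 0 \/ E e)).

Lemma sup0_lub (E : R -> Prop) (B : R) : (forall e, E e -> e <= B) ->
  is_lub (fun e => e = 0 \/ E e) (sup0 E).
Proof.
  intro H. unfold sup0. apply epsilon_spec.
  destruct (completeness (fun e => e = 0 \/ E e)) as [m Hm].
  - exists (Rmax 0 B). intros e [-> | He]; [apply Rmax_l|].
    eapply Rle_trans; [now apply H | apply Rmax_r].
  - exists 0. now left.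
  - now exists m.
Qed.

Definition bounded (J : Type) (w : J -> R) : Prop := exists B, forall j, w j <= B.

Definition supf (J : Type) (w : J -> R) : R := sup0 (fun e => exists j, e = w j).

Lemma supf_lub (J : Type) (w : J -> R) : bounded J w ->
  is_lub (fun e => e = 0 \/ exists j, e = w j) (supf J w).
Proof. intros [B HB]. apply sup0_lub with B. intros e [j ->]. apply HB. Qed.

Lemma supf_ge (J : Type) (w : J -> R) (j : J) : bounded J w -> w j <= supf J w.
Proof. intro H. apply (supf_lub J w H). right. now exists j. Qed.

Lemma supf_nonneg (J : Type) (w : J -> R) : bounded J w -> 0 <= supf J w.
Proof. intro H. apply (supf_lub J w H). now left. Qed.

Lemma supf_le (J : Type) (w : J -> R) (B : R) : 0 <= B -> (forall j, w j <= B) -> supf J w <= B.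
Proof.
  intros HB H. apply (supf_lub J w); [now exists B|]. intros e [-> | [j ->]]; auto.
Qed.

Lemma supf_lip (J : Type) (w w' : J -> R) (e : R) : bounded J w' ->
  0 < e -> (forall j, Rabs (w j - w' j) <= e) -> Rabs (supf J w - supf J w') <= e.
Proof.
  intros Hb He H.
  assert (H1 : forall j, w j <= w' j + e /\ w' j <= w j + e).
  { intro j. specialize (H j). apply Rabs_le_bounds in H. lra. }
  assert (Hb' : bounded J w).
  { destruct Hb as [B HB]. exists (B + e). intro j. specialize (HB j). destruct (H1 j). lra. }
  generalize (supf_nonneg J w Hb') (supf_nonneg J w' Hb); intros.
  apply Rabs_le. split.
  - enough (supf J w' <= supf J w + e) by lra. apply supf_le; [lra|].
    intro j. generalize (supf_ge J w j Hb'). destruct (H1 j). lra.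
  - enough (supf J w <= supf J w' + e) by lra. apply supf_le; [lra|].
    intro j. generalize (supf_ge J w' j Hb). destruct (H1 j). lra.
Qed.

Lemma list_argmax (J : Type) (w : J -> R) (l : list J) : l <> nil ->
  exists j, In j l /\ forall i, In i l -> w i <= w j.
Proof.
  induction l as [|a l IH]; [now intros []|]. intros _.
  destruct l as [|b l'].
  - exists a. split; [now left|]. intros i [-> | []]. lra.
  - destruct IH as [j [Hj Hmax]]; [discriminate|].
    destruct (Rle_dec (w a) (w j)) as [Hle | Hgt].
    + exists j. split; [now right|]. intros i [<- | Hi]; [exact Hle | now apply Hmax].
    + exists a. split; [now left|]. intros i [<- | Hi]; [lra|].
      specialize (Hmax i Hi). lra.
Qed.

Lemma supported_bounded (J : Type) (w : J -> R) (l : list J) : supported w l -> bounded J w.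
Proof.
  intro H. destruct l as [|a l].
  - exists 0. intro j. rewrite H; [lra | intros []].
  - destruct (list_argmax J w (a :: l)) as [j [_ Hj]]; [discriminate|].
    exists (Rmax 0 (w j)). intro i. destruct (classic (In i (a :: l))) as [Hi | Hi].
    + eapply Rle_trans; [now apply Hj | apply Rmax_r].
    + rewrite H by exact Hi. apply Rmax_l.
Qed.

Lemma supf_attained (J : Type) (w : J -> R) (l : list J) : supported w l ->
  (exists j, 0 < w j) -> exists j, w j = supf J w /\ 0 < w j.
Proof.
  intros H [j0 H0].
  assert (Hin : forall i, 0 < w i -> In i l).
  { intros i Hi. apply NNPP. intro N. apply H in N. lra. }
  destruct (list_argmax J w l) as [j [Hj Hmax]].
  { intro E. specialize (Hin _ H0). now rewrite E in Hin. }
  assert (Hj0 : 0 < w j) by (specialize (Hmax _ (Hin _ H0)); lra).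
  exists j. split; [|exact Hj0]. apply Rle_antisym.
  - apply supf_ge. now apply supported_bounded with l.
  - apply supf_le; [lra|]. intro i. destruct (Rlt_dec 0 (w i)) as [Hi | Hi].
    + now apply Hmax, Hin.
    + lra.
Qed.

(** The clause [e <= w i] compares with weight 0, so that the weights in [S] must be positive even
    when nothing lies outside [S]. The empty set is excluded because every positive [e] would
    satisfy the rest. *)
Definition gap_ge (J : Type) (S : J -> Prop) (w : J -> R) (e : R) : Prop :=
  0 < e /\ (exists i, S i) /\ forall i, S i -> e <= w i /\ forall j, ~ S j -> e <= w i - w j.

(* The positive part of [min_S w - max_{J \ S} w]: the weight, in the layer-cake decomposition
   of [w], of the superlevel set [S].  For a point of a simplex these are, up to factors, the
   barycentric coordinates in the barycentric subdivision. *)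
Definition gap (J : Type) (w : J -> R) (S : J -> Prop) : R := sup0 (gap_ge J S w).

Definition active (J : Type) (w : J -> R) (S : J -> Prop) : Prop := 0 < gap J w S.

Lemma gap_lub (J : Type) (S : J -> Prop) (w : J -> R) :
  is_lub (fun e => e = 0 \/ gap_ge J S w e) (gap J w S).
Proof.
  destruct (classic (exists i, S i)) as [[i Hi] | N].
  - apply sup0_lub with (w i). intros e [_ [_ H]]. now apply H.
  - apply sup0_lub with 0. intros e [_ [H _]]. contradiction.
Qed.

Lemma gap_nonneg (J : Type) (S : J -> Prop) (w : J -> R) : 0 <= gap J w S.
Proof. apply gap_lub. now left. Qed.

Lemma gap_ge_le (J : Type) (S : J -> Prop) (w : J -> R) (e : R) : gap_ge J S w e -> e <= gap J w S.
Proof. intro H. apply gap_lub. now right. Qed.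

(** All bounds on [e] are non-strict upper bounds, so the supremum satisfies them once some positive
    [e] does. *)
Lemma active_gap_ge (J : Type) (S : J -> Prop) (w : J -> R) : active J w S -> gap_ge J S w (gap J w S).
Proof.
  intro H. unfold active in H. destruct (gap_lub J S w) as [_ Hl].
  assert (H0 : exists e, gap_ge J S w e).
  { apply NNPP. intro N. assert (gap J w S <= 0); [|lra].
    apply Hl. intros e [-> | He]; [lra|]. exfalso. apply N. now exists e. }
  destruct H0 as [e0 [He0 [Hi0 H0]]].
  split; [exact H|]. split; [exact Hi0|]. intros i Hi. destruct (H0 i Hi) as [Hw Hd]. split.
  - apply Hl. intros e [-> | [_ [_ He]]]; [lra | now apply He].
  - intros j Hj. specialize (Hd j Hj). apply Hl. intros e [-> | [_ [_ He]]]; [lra | now apply He].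
Qed.

Lemma active_pos (J : Type) (S : J -> Prop) (w : J -> R) (i : J) :
  active J w S -> S i -> gap J w S <= w i.
Proof. intros H Hi. destruct (active_gap_ge J S w H) as [_ [_ H1]]. now apply H1. Qed.

Lemma active_sep (J : Type) (S : J -> Prop) (w : J -> R) (i j : J) :
  active J w S -> S i -> ~ S j -> gap J w S <= w i - w j.
Proof. intros H Hi. destruct (active_gap_ge J S w H) as [_ [_ H1]]. now apply H1. Qed.

Lemma active_inhabited (J : Type) (S : J -> Prop) (w : J -> R) : active J w S -> exists i, S i.
Proof. intro H. now destruct (active_gap_ge J S w H) as [_ [H1 _]]. Qed.

Lemma active_supp (J : Type) (S : J -> Prop) (w : J -> R) (l : list J) :
  supported w l -> active J w S -> forall i, S i -> In i l.
Proof.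
  intros Hs H i Hi. apply NNPP. intro N. apply Hs in N.
  generalize (active_pos J S w i H Hi). unfold active in H. lra.
Qed.

Lemma active_superlevel (J : Type) (S : J -> Prop) (w : J -> R) (i j : J) :
  active J w S -> S i -> w i <= w j -> S j.
Proof.
  intros H Hi Hw. apply NNPP. intro N. generalize (active_sep J S w i j H Hi N).
  unfold active in H. lra.
Qed.

(** Source of all nonempty intersections: an index of maximal weight is common to all active
    sets. *)
Lemma active_max (J : Type) (S : J -> Prop) (w : J -> R) (j : J) :
  active J w S -> (forall i, w i <= w j) -> S j.
Proof.
  intros H Hm. destruct (active_inhabited J S w H) as [i Hi].
  now apply active_superlevel with w i.
Qed.

Lemma active_chain (J : Type) (S T : J -> Prop) (w : J -> R) :
  active J w S -> active J w T -> (forall i, S i -> T i) \/ (forall i, T i -> S i).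
Proof.
  intros HS HT. apply NNPP. intro N. apply not_or_and in N. destruct N as [N1 N2].
  apply not_all_ex_not in N1, N2. destruct N1 as [i Hi], N2 as [j Hj].
  apply imply_to_and in Hi, Hj.
  destruct (Rle_dec (w i) (w j)).
  - apply (proj2 Hj). apply active_superlevel with w i; tauto.
  - apply (proj2 Hi). apply active_superlevel with w j; [tauto | tauto | lra].
Qed.

Lemma gap_le (J : Type) (S : J -> Prop) (w : J -> R) (B : R) : 0 <= B ->
  (forall i, w i <= B) -> gap J w S <= B.
Proof.
  intros HB H. destruct (Rlt_dec 0 (gap J w S)) as [Ha | Ha]; [|lra].
  destruct (active_inhabited J S w Ha) as [i Hi].
  generalize (active_pos J S w i Ha Hi) (H i). lra.
Qed.

Lemma gap_bounded (J : Type) (w : J -> R) : bounded J w -> bounded (J -> Prop) (gap J w).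
Proof.
  intros [B HB]. exists (Rmax 0 B). intro S. apply gap_le; [apply Rmax_l|].
  intro i. eapply Rle_trans; [apply HB | apply Rmax_r].
Qed.

(** The factor 2 comes from the differences [w i - w j], in which both terms move by [e]. *)
Lemma gap_lip_half (J : Type) (S : J -> Prop) (w w' : J -> R) (e : R) : 0 < e ->
  (forall i, Rabs (w i - w' i) <= e) -> gap J w S <= gap J w' S + 2 * e.
Proof.
  intros He H. destruct (Rle_dec (gap J w S) (2 * e)) as [Hle | Hgt].
  { generalize (gap_nonneg J S w'). lra. }
  assert (Ha : active J w S) by (unfold active; lra).
  enough (gap J w S - 2 * e <= gap J w' S) by lra.
  assert (H1 : forall i, w i - e <= w' i <= w i + e).
  { intro i. specialize (H i). apply Rabs_le_bounds in H. lra. }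
  apply gap_ge_le. split; [lra|]. split; [now apply active_inhabited with w|].
  intros i Hi. split.
  - generalize (active_pos J S w i Ha Hi) (H1 i). lra.
  - intros j Hj. generalize (active_sep J S w i j Ha Hi Hj) (H1 i) (H1 j). lra.
Qed.

Lemma gap_lip (J : Type) (S : J -> Prop) (w w' : J -> R) (e : R) : 0 < e ->
  (forall i, Rabs (w i - w' i) <= e) -> Rabs (gap J w S - gap J w' S) <= 2 * e.
Proof.
  intros He H. apply Rabs_le. split.
  - enough (gap J w' S <= gap J w S + 2 * e) by lra. apply gap_lip_half; [exact He|].
    intro i. rewrite Rabs_minus_sym. apply H.
  - enough (gap J w S <= gap J w' S + 2 * e) by lra. now apply gap_lip_half.
Qed.

(** * Finite subsets *)

Fixpoint subsets (J : Type) (l : list J) : list (J -> Prop) :=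
  match l with
  | nil => (fun _ => False) :: nil
  | a :: l' => subsets J l' ++ map (fun S i => i = a \/ S i) (subsets J l')
  end.

Lemma subsets_spec (J : Type) (l : list J) (S : J -> Prop) :
  In S (subsets J l) <-> forall i, S i -> In i l.
Proof.
  revert S. induction l as [|a l IH]; intro S; cbn.
  - split.
    + intros [<- | []] i [].
    + intro H. left. apply pred_ext. intro i. split; [intros [] | apply H].
  - rewrite in_app_iff, in_map_iff. split.
    + intros [H | [T [<- H]]] i Hi.
      * right. now apply (proj1 (IH S)).
      * destruct Hi as [-> | Hi]; [now left | right; now apply (proj1 (IH T))].
    + intro H. destruct (classic (S a)) as [Ha | Ha].
      * right. exists (fun i => S i /\ i <> a). split.
        -- apply pred_ext. intro i. split; [intros [-> | []]; tauto|].
           intro Hi. destruct (classic (i = a)); tauto.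
        -- apply IH. intros i [Hi Hne]. destruct (H i Hi); congruence.
      * left. apply IH. intros i Hi. destruct (H i Hi) as [<- |]; tauto.
Qed.

Definition dec_eq (J : Type) (x y : J) : {x = y} + {x <> y} := excluded_middle_informative (x = y).

Definition dec_in (J : Type) (P : J -> Prop) (i : J) : bool :=
  if excluded_middle_informative (P i) then true else false.

Lemma dec_in_true (J : Type) (P : J -> Prop) (i : J) : dec_in J P i = true <-> P i.
Proof.
  unfold dec_in. destruct (excluded_middle_informative (P i)); split; auto; discriminate.
Qed.

Definition enum (J : Type) (P : J -> Prop) (l : list J) : list J :=
  nodup (dec_eq J) (filter (dec_in J P) l).

Lemma enum_In (J : Type) (P : J -> Prop) (l : list J) (i : J) : In i (enum J P l) <-> In i l /\ P i.
Proof. unfold enum. rewrite nodup_In, filter_In, dec_in_true. tauto. Qed.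

Lemma enum_NoDup (J : Type) (P : J -> Prop) (l : list J) : NoDup (enum J P l).
Proof. apply NoDup_nodup. Qed.

(** The support is the lowest superlevel set, and being finite it has a least positive weight, which
    bounds its gap from below. This supplies an active set whenever the weights are not all 0. *)
Lemma active_support (J : Type) (w : J -> R) (l : list J) : supported w l ->
  (exists i, 0 < w i) -> (forall i, 0 <= w i) -> active J w (fun i => 0 < w i).
Proof.
  intros Hs [i0 Hi0] Hpos.
  assert (Hin : forall i, 0 < w i -> In i (enum J (fun i => 0 < w i) l)).
  { intros i Hi. apply enum_In. split; [|exact Hi]. apply NNPP. intro N. apply Hs in N. lra. }
  destruct (list_argmax J (fun i => - w i) (enum J (fun i => 0 < w i) l)) as [j [Hj Hmin]].
  { intro E. apply Hin in Hi0. now rewrite E in Hi0. }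
  apply enum_In in Hj. destruct Hj as [_ Hj].
  apply Rlt_le_trans with (w j); [exact Hj|].
  apply gap_ge_le. split; [exact Hj|]. split; [now exists j|]. intros i Hi.
  apply Hin, Hmin in Hi. split; [lra|]. intros k Hk. specialize (Hpos k). lra.
Qed.

Definition card (J : Type) (S : J -> Prop) (k : nat) : Prop :=
  exists l, NoDup l /\ length l = k /\ forall i, In i l <-> S i.

Lemma card_subset (J : Type) (S : J -> Prop) (l : list J) : (forall i, S i -> In i l) ->
  exists k, card J S k /\ (k <= length l)%nat.
Proof.
  intro H. exists (length (enum J S l)). split.
  - exists (enum J S l). split; [apply enum_NoDup|]. split; [reflexivity|].
    intro i. rewrite enum_In. split; [tauto | auto].
  - apply NoDup_incl_length; [apply enum_NoDup|]. intros i Hi. now apply enum_In in Hi.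
Qed.

Lemma card_eq (J : Type) (S T : J -> Prop) (j k : nat) : card J S j -> card J T k -> (k <= j)%nat ->
  (forall i, S i -> T i) -> S = T.
Proof.
  intros [l [Hl [El Sl]]] [m [Hm [Em Tm]]] Hjk H. apply pred_ext. intro i. split; [apply H|].
  intro Hi. apply Sl. apply (NoDup_length_incl (l:=l) (l':=m)); [exact Hl | lia | | now apply Tm].
  intros x Hx. apply Tm, H, Sl, Hx.
Qed.

Lemma card_pos (J : Type) (S : J -> Prop) (k : nat) : card J S k -> (exists i, S i) -> (0 < k)%nat.
Proof.
  intros [l [_ [<- H]]] [i Hi]. apply H in Hi. destruct l; [destruct Hi | cbn; lia].
Qed.

(** Nested finite sets of equal size coincide. Hence the chain of active sets can be visited by
    cardinality, with at most one set per number. *)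
Lemma active_card_eq (J : Type) (S T : J -> Prop) (w : J -> R) (k : nat) :
  active J w S -> active J w T -> card J S k -> card J T k -> S = T.
Proof.
  intros HS HT CS CT. destruct (active_chain J S T w HS HT).
  - now apply card_eq with k k.
  - symmetry. now apply card_eq with k k.
Qed.

Lemma active_card_lt (J : Type) (S T : J -> Prop) (w : J -> R) (j k : nat) :
  active J w S -> active J w T -> card J S j -> card J T k -> (j <= k)%nat -> forall i, S i -> T i.
Proof.
  intros HS HT CS CT Hjk. destruct (active_chain J S T w HS HT) as [H | H]; [exact H|].
  rewrite (card_eq J T S k j CT CS Hjk H). auto.
Qed.

(** * Folding contractions along a chain *)

(** Encoded by a total function with all clauses relative to [P] and to times in [0, 1], so that
    contractions of different intersections compose without subtypes. *)
Record contraction (X : Type) (d : X -> X -> R) (P : X -> Prop) (h : X -> R -> X) : Prop := {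
  ctr_mem : forall x s, P x -> 0 <= s <= 1 -> P (h x s);
  ctr_0 : forall x, P x -> h x 0 = x;
  ctr_1 : forall x y, P x -> P y -> h x 1 = h y 1;
  ctr_lim : forall x s e, P x -> 0 <= s <= 1 -> 0 < e ->
    exists delta, 0 < delta /\ forall y t, P y -> 0 <= t <= 1 ->
      d x y < delta -> Rabs (t - s) < delta -> d (h x s) (h y t) < e }.

Lemma lim_gap (Z J : Type) (F : (Z -> Prop) -> Prop) (w : Z -> J -> R) (w0 : J -> R) :
  is_filter Z F -> unif_lim Z J F w w0 -> unif_lim Z (J -> Prop) F (fun z => gap J (w z)) (gap J w0).
Proof.
  intro HF. apply unif_lim_lip with 2; [exact HF | lra|].
  intros z e He H S. now apply gap_lip.
Qed.

Lemma lim_supf (Z J : Type) (F : (Z -> Prop) -> Prop) (w : Z -> J -> R) (w0 : J -> R) :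
  is_filter Z F -> bounded J w0 -> unif_lim Z J F w w0 -> lim Z F (fun z => supf J (w z)) (supf J w0).
Proof.
  intros HF Hb Hw e He. eapply (filt_imp _ _ HF). 2: exact (Hw (e / 2) ltac:(lra)).
  cbn. intros z Hz. assert (Rabs (supf J (w z) - supf J w0) <= e / 2); [|lra].
  apply supf_lip; [exact Hb | lra | exact Hz].
Qed.

Section Fold.
Context (X I : Type) (d : X -> X -> R) (A : I -> X -> Prop) (K : (I -> Prop) -> X -> R -> X).

Definition meet (S : I -> Prop) (x : X) : Prop := forall i, S i -> A i x.

Context (HK : forall S l, (forall i, S i -> In i l) -> (exists i, S i) -> (exists x, meet S x) ->
  contraction X d (meet S) (K S)).

Definition max_gap (w : I -> R) : R := supf (I -> Prop) (gap I w).

Definition time (w : I -> R) (S : I -> Prop) : R := gap I w S / max_gap w.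

Definition level (w : I -> R) (k : nat) : I -> Prop :=
  epsilon (inhabits (fun _ => True)) (fun S => active I w S /\ card I S k).

Definition step (w : I -> R) (s : R) (k : nat) (x : X) : X :=
  if excluded_middle_informative (exists S, active I w S /\ card I S k)
  then K (level w k) x (s * time w (level w k)) else x.

(** Cardinalities run from [n] down to 1: larger index sets have smaller intersections, and a point
    of a smaller intersection may be fed to every later contraction. The factor [s] scales all times
    at once, for the homotopy on [X]. *)
Fixpoint fold (w : I -> R) (s : R) (n : nat) (x : X) : X :=
  match n with
  | O => x
  | S k => fold w s k (step w s (S k) x)
  end.

Lemma step_active (w : I -> R) (s : R) (k : nat) (x : X) (S : I -> Prop) :
  active I w S -> card I S k -> step w s k x = K S x (s * time w S).
Proof.
  intros H C. unfold step. destruct excluded_middle_informative as [E | N].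
  - replace (level w k) with S; [reflexivity|].
    unfold level. destruct (epsilon_spec (inhabits (fun _ => True)) _ E) as [H1 C1].
    now apply active_card_eq with w k.
  - exfalso. apply N. now exists S.
Qed.

Lemma step_none (w : I -> R) (s : R) (k : nat) (x : X) :
  ~ (exists S, active I w S /\ card I S k) -> step w s k x = x.
Proof. intro H. unfold step. destruct excluded_middle_informative; [contradiction | reflexivity]. Qed.

Lemma max_gap_pos (w : I -> R) (l : list I) (S : I -> Prop) :
  supported w l -> active I w S -> 0 < max_gap w.
Proof.
  intros Hs H. apply Rlt_le_trans with (gap I w S); [exact H|].
  apply supf_ge, gap_bounded. now apply supported_bounded with l.
Qed.

Lemma time_range (w : I -> R) (l : list I) (S : I -> Prop) :
  supported w l -> 0 < max_gap w -> 0 <= time w S <= 1.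
Proof.
  intros Hs HM. unfold time.
  assert (H1 : gap I w S <= max_gap w).
  { apply supf_ge, gap_bounded. now apply supported_bounded with l. }
  generalize (gap_nonneg I S w); intro H0. split.
  - apply Rmult_le_pos; [exact H0|]. left. now apply Rinv_0_lt_compat.
  - apply Rmult_le_reg_r with (max_gap w); [exact HM|].
    unfold Rdiv. rewrite Rmult_assoc, Rinv_l by lra. lra.
Qed.

Lemma scaled_time_range (w : I -> R) (l : list I) (S : I -> Prop) (s : R) :
  supported w l -> 0 < max_gap w -> 0 <= s <= 1 -> 0 <= s * time w S <= 1.
Proof. intros Hs HM H. generalize (time_range w l S Hs HM). intros. split; nra. Qed.

(* Invariant after the levels of cardinality [> n] have been processed: the current point lies in
   every intersection indexed by a set that could still be processed here or at a nearby weight. *)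
Definition pending (L : list I) (w : I -> R) (n : nat) (x : X) : Prop :=
  forall T, (forall i, T i -> In i L) ->
    (forall S m, active I w S -> card I S m -> (n < m)%nat -> forall i, T i -> S i) -> meet T x.

Lemma pending_start (L : list I) (w : I -> R) (n : nat) (x : X) :
  (forall i, In i L -> A i x) -> pending L w n x.
Proof. intros H T HT _ i Hi. auto. Qed.

Lemma pending_active (L : list I) (w : I -> R) (n : nat) (x : X) (S : I -> Prop) :
  supported w L -> pending L w n x -> active I w S -> card I S n -> meet S x.
Proof.
  intros Hs Hx H C. apply Hx.
  - now apply active_supp with w.
  - intros S' m H' C' Hm. apply active_card_lt with w n m; auto; lia.
Qed.

Lemma active_contraction (L : list I) (w : I -> R) (x : X) (S : I -> Prop) :
  supported w L -> active I w S -> meet S x -> contraction X d (meet S) (K S).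
Proof.
  intros Hs H Hx. apply HK with L.
  - now apply active_supp with w.
  - now apply active_inhabited with w.
  - now exists x.
Qed.

Lemma pending_step (L : list I) (w : I -> R) (s : R) (k : nat) (x : X) :
  supported w L -> 0 <= s <= 1 -> pending L w (S k) x -> pending L w k (step w s (S k) x).
Proof.
  intros Hs Hsr Hx T HT HA.
  destruct (classic (exists S', active I w S' /\ card I S' (S k))) as [[S' [H C]] | N].
  - rewrite (step_active w s (S k) x S' H C).
    assert (Hm : meet S' x) by now apply pending_active with L w (S k).
    assert (Hm' : meet S' (K S' x (s * time w S'))).
    { apply (active_contraction L w x S' Hs H Hm); [exact Hm|].
      apply scaled_time_range with L; auto. now apply max_gap_pos with L S'. }
    intros i Hi. apply Hm'. apply HA with (S k); auto.
  - rewrite step_none by exact N. apply Hx; [exact HT|].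
    intros S' m H C Hm. apply HA with m; auto. lia.
Qed.

Lemma pending_fold (L : list I) (w : I -> R) (s : R) (n : nat) (x : X) :
  supported w L -> 0 <= s <= 1 -> pending L w n x -> pending L w 0 (fold w s n x).
Proof.
  intros Hs Hsr. revert x. induction n as [|n IH]; intros x Hx; [exact Hx|].
  cbn. now apply IH, pending_step.
Qed.

(** The final invariant, applied to the singleton of [i]: a region whose index lies in all active
    sets is never left. *)
Lemma fold_mem (L : list I) (w : I -> R) (s : R) (n : nat) (x : X) (i : I) :
  supported w L -> 0 <= s <= 1 -> pending L w n x -> In i L ->
  (forall S, active I w S -> S i) -> A i (fold w s n x).
Proof.
  intros Hs Hsr Hx Hi HA.
  apply (pending_fold L w s n x Hs Hsr Hx (fun j => j = i)); [now intros j -> | | reflexivity].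
  intros S m H _ _ j ->. now apply HA.
Qed.

Lemma fold_bound (w : I -> R) (s : R) (n m : nat) (x : X) :
  (forall S k, active I w S -> card I S k -> (k <= n)%nat) -> (n <= m)%nat -> fold w s m x = fold w s n x.
Proof.
  intros Hn Hm. induction Hm as [|m Hm IH]; [reflexivity|]. cbn.
  rewrite step_none; [exact IH|]. intros [S [H C]]. specialize (Hn S _ H C). lia.
Qed.

Lemma fold_0 (L : list I) (w : I -> R) (n : nat) (x : X) :
  supported w L -> pending L w n x -> fold w 0 n x = x.
Proof.
  intro Hs. revert x. induction n as [|n IH]; intros x Hx; [reflexivity|]. cbn.
  assert (E : step w 0 (S n) x = x).
  { destruct (classic (exists S', active I w S' /\ card I S' (S n))) as [[S' [H C]] | N].
    - rewrite (step_active w 0 (S n) x S' H C), Rmult_0_l.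
      assert (Hm : meet S' x) by now apply pending_active with L w (S n).
      now apply (active_contraction L w x S' Hs H Hm).
    - now apply step_none. }
  rewrite <- E at 2. rewrite <- (IH (step w 0 (S n) x)) at 2; [reflexivity|].
  apply pending_step; auto. lra.
Qed.

(* Some level has time 1, and its contraction forgets the starting point. *)
Lemma fold_start (L : list I) (w : I -> R) (n : nat) (x y : X) :
  supported w L -> (exists S k, active I w S /\ card I S k /\ (k <= n)%nat /\ time w S = 1) ->
  pending L w n x -> pending L w n y -> fold w 1 n x = fold w 1 n y.
Proof.
  intros Hs [S0 [k [H [C [Hk E]]]]]. revert x y. induction Hk as [|n Hk IH]; intros x y Hx Hy.
  - destruct k as [|k].
    { generalize (card_pos I S0 0 C (active_inhabited I S0 w H)). lia. }
    cbn. rewrite !(step_active w 1 (S k) _ S0 H C), E, Rmult_1_r.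
    assert (Hm : meet S0 x) by now apply pending_active with L w (S k).
    f_equal. apply (active_contraction L w x S0 Hs H Hm); [exact Hm|].
    now apply pending_active with L w (S k).
  - cbn. apply IH; apply pending_step; auto; lra.
Qed.

(** Gaps are nonzero only on the finitely many subsets of [L], so [max_gap] is attained, and there
    the quotient is 1. *)
Lemma time_attained (L : list I) (w : I -> R) : supported w L -> (forall i, 0 <= w i) ->
  (exists i, 0 < w i) -> exists S k, active I w S /\ card I S k /\ (k <= length L)%nat /\ time w S = 1.
Proof.
  intros Hs Hpos Hex.
  destruct (supf_attained (I -> Prop) (gap I w) (subsets I L)) as [S [E H]].
  - intros S HS. destruct (Rlt_dec 0 (gap I w S)) as [Ha | Ha].
    + exfalso. apply HS. apply subsets_spec. now apply active_supp with w.
    + generalize (gap_nonneg I S w). lra.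
  - exists (fun i => 0 < w i). now apply active_support with L.
  - destruct (card_subset I S L) as [k [C Hk]]; [now apply active_supp with w|].
    exists S, k. repeat split; auto. unfold time, max_gap. rewrite <- E. field. lra.
Qed.

Section FoldLim.
Context (Z : Type) (F : (Z -> Prop) -> Prop) (HF : is_filter Z F) (L : list I).
Context (w : Z -> I -> R) (w0 : I -> R) (s : Z -> R) (s0 : R).
Context (Hw : unif_lim Z I F w w0) (HwL : F (fun z => supported (w z) L)) (Hw0 : supported w0 L).
Context (Hpos : 0 < max_gap w0).
Context (Hs : lim Z F s s0) (Hsr : F (fun z => 0 <= s z <= 1)) (Hs0 : 0 <= s0 <= 1).

Lemma time_lim (S : I -> Prop) : lim Z F (fun z => s z * time (w z) S) (s0 * time w0 S).
Proof.
  apply lim_mult; auto. apply lim_div; auto.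
  - apply (unif_lim_at Z F HF (I -> Prop) (fun z => gap I (w z))). now apply lim_gap.
  - apply lim_supf; auto.
    + apply gap_bounded. now apply supported_bounded with L.
    + now apply lim_gap.
Qed.

Lemma max_gap_eventually_pos : F (fun z => 0 < max_gap (w z)).
Proof.
  apply (lim_gt Z F HF _ (max_gap w0) 0 Hpos). apply lim_supf; auto.
  - apply gap_bounded. now apply supported_bounded with L.
  - now apply lim_gap.
Qed.

(** Being active is a strict inequality, and only the finitely many subsets of [L] matter. Nearby
    weights may have further active sets, but lose none. *)
Lemma active_stable : F (fun z => forall T, active I w0 T -> active I (w z) T).
Proof.
  apply (filt_imp _ _ HF (fun z => forall T, In T (subsets I L) -> active I w0 T -> active I (w z) T)).
  - intros z H T HT. apply H; [|exact HT]. apply subsets_spec. now apply active_supp with w0.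
  - apply filt_list; [exact HF|]. intros T _.
    destruct (Rlt_dec 0 (gap I w0 T)) as [H | H].
    + apply (filt_imp _ _ HF (fun z => 0 < gap I (w z) T)); [auto|].
      apply (lim_gt Z F HF _ (gap I w0 T) 0 H).
      apply (unif_lim_at Z F HF (I -> Prop) (fun z => gap I (w z))). now apply lim_gap.
    + apply filt_all; [exact HF|]. intros z HT. contradiction.
Qed.

Lemma contraction_lim (S : I -> Prop) (y : Z -> X) (y0 : X) (e : R) :
  contraction X d (meet S) (K S) -> metric_lim X Z d F y y0 -> meet S y0 -> 0 < e ->
  F (fun z => meet S (y z) -> d (K S y0 (s0 * time w0 S)) (K S (y z) (s z * time (w z) S)) < e).
Proof.
  intros HC Hy Hm He.
  destruct (ctr_lim _ _ _ _ HC y0 (s0 * time w0 S) e Hm) as [delta [Hdel H]]; [|exact He|].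
  { now apply scaled_time_range with L. }
  eapply (filt_imp _ _ HF).
  2: exact (filt_and _ _ HF _ _ HwL (filt_and _ _ HF _ _ max_gap_eventually_pos
       (filt_and _ _ HF _ _ Hsr (filt_and _ _ HF _ _ (Hy _ Hdel) (time_lim S _ Hdel))))).
  cbn. intros z [H1 [H2 [H3 [H4 H5]]]] Hmz. apply H; auto. now apply scaled_time_range with L.
Qed.

Lemma step_lim (k : nat) (y : Z -> X) (y0 : X) :
  metric_lim X Z d F y y0 -> F (fun z => pending L (w z) (S k) (y z)) -> pending L w0 (S k) y0 ->
  metric_lim X Z d F (fun z => step (w z) (s z) (S k) (y z)) (step w0 s0 (S k) y0).
Proof.
  intros Hy Hyp Hy0 e He.
  destruct (classic (exists S', active I w0 S' /\ card I S' (S k))) as [[S' [H C]] | N].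
  - rewrite (step_active w0 s0 (S k) y0 S' H C).
    assert (Hm : meet S' y0) by now apply pending_active with L w0 (S k).
    eapply (filt_imp _ _ HF).
    2: exact (filt_and _ _ HF _ _ HwL (filt_and _ _ HF _ _ active_stable (filt_and _ _ HF _ _ Hyp
       (contraction_lim S' y y0 e (active_contraction L w0 y0 S' Hw0 H Hm) Hy Hm He)))).
    cbn. intros z [H1 [H2 [H3 H4]]]. rewrite (step_active (w z) (s z) (S k) (y z) S'); auto.
    apply H4. apply pending_active with L (w z) (S k); auto.
  - rewrite step_none by exact N.
    (* any level active near [w0] but not at [w0] lies below the chain of [w0] and has time near 0 *)
    assert (HT : F (fun z => forall T, In T (subsets I L) -> (exists i, T i) -> ~ active I w0 T -> meet T y0 ->
                meet T (y z) -> d y0 (K T (y z) (s z * time (w z) T)) < e)).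
    { apply filt_list; [exact HF|]. intros T HT.
      destruct (classic ((exists i, T i) /\ ~ active I w0 T /\ meet T y0)) as [[Hi [Hna Hm]] | N'].
      - assert (HC : contraction X d (meet T) (K T)).
        { apply HK with L; [now apply subsets_spec | exact Hi | now exists y0]. }
        eapply (filt_imp _ _ HF). 2: exact (contraction_lim T y y0 e HC Hy Hm He).
        cbn. intros z Hz _ _ _ Hmz. specialize (Hz Hmz).
        assert (E : s0 * time w0 T = 0).
        { unfold time. replace (gap I w0 T) with 0; [unfold Rdiv; ring|].
          generalize (gap_nonneg I T w0). unfold active in Hna. lra. }
        rewrite E, (ctr_0 _ _ _ _ HC y0 Hm) in Hz. exact Hz.
      - apply filt_all; [exact HF|]. intros z H1 H2 H3. exfalso. tauto. }
    eapply (filt_imp _ _ HF).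
    2: exact (filt_and _ _ HF _ _ HwL (filt_and _ _ HF _ _ active_stable (filt_and _ _ HF _ _ Hyp
       (filt_and _ _ HF _ _ (Hy e He) HT)))).
    cbn. intros z [H1 [H2 [H3 [H4 H5]]]].
    destruct (classic (exists T, active I (w z) T /\ card I T (S k))) as [[T [H C]] | N'].
    + rewrite (step_active (w z) (s z) (S k) (y z) T H C).
      assert (HTL : forall i, T i -> In i L) by now apply active_supp with (w z).
      apply H5.
      * now apply subsets_spec.
      * now apply active_inhabited with (w z).
      * intro Ha. apply N. now exists T.
      (* Here [pending] is needed for a set not active at [w0]: the larger active sets of [w0] are
         still active at [w z], hence contain [T], and so [y0] lies in [meet T]. *)
      * apply Hy0; [exact HTL|]. intros S' m HS' CS' Hm.
        apply active_card_lt with (w z) (S k) m; auto. lia.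
      * now apply pending_active with L (w z) (S k).
    + now rewrite step_none by exact N'.
Qed.

Lemma fold_lim (n : nat) (y : Z -> X) (y0 : X) :
  metric_lim X Z d F y y0 -> F (fun z => pending L (w z) n (y z)) -> pending L w0 n y0 ->
  metric_lim X Z d F (fun z => fold (w z) (s z) n (y z)) (fold w0 s0 n y0).
Proof.
  revert y y0. induction n as [|n IH]; intros y y0 Hy Hyp Hy0; [exact Hy|]. cbn.
  apply IH.
  - now apply step_lim.
  - eapply (filt_imp _ _ HF). 2: exact (filt_and _ _ HF _ _ HwL (filt_and _ _ HF _ _ Hsr Hyp)).
    cbn. intros z [H1 [H2 H3]]. now apply pending_step.
  - now apply pending_step.
Qed.

End FoldLim.
End Fold.

(** * Continuity into and out of Rips complexes *)

Lemma sumR_ext (X : Type) (u v : X -> R) (l : list X) :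
  (forall x, In x l -> u x = v x) -> sumR u l = sumR v l.
Proof.
  induction l as [|a l IH]; intro H; cbn; [reflexivity|].
  rewrite (H a), IH; auto; [intros x Hx; apply H; now right | now left].
Qed.

Lemma sumR_scal (X : Type) (u : X -> R) (c : R) (l : list X) :
  sumR (fun x => c * u x) l = c * sumR u l.
Proof. induction l as [|a l IH]; cbn; [ring | rewrite IH; ring]. Qed.

Lemma sumR_perm (X : Type) (u : X -> R) (l l' : list X) : Permutation l l' -> sumR u l = sumR u l'.
Proof. induction 1; cbn; lra. Qed.

Lemma sumR_filter (X : Type) (u : X -> R) (l : list X) :
  sumR u (filter (dec_in X (fun x => u x <> 0)) l) = sumR u l.
Proof.
  induction l as [|a l IH]; cbn; [reflexivity|].
  destruct (dec_in X (fun x => u x <> 0) a) eqn:E; cbn; rewrite IH; [reflexivity|].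
  assert (u a = 0); [|lra].
  apply NNPP. intro N. apply (dec_in_true X (fun x => u x <> 0)) in N. congruence.
Qed.

Lemma sumR_supported (X : Type) (u : X -> R) (l l' : list X) : NoDup l -> NoDup l' ->
  supported u l -> supported u l' -> sumR u l = sumR u l'.
Proof.
  intros H H' Hs Hs'. rewrite <- (sumR_filter X u l), <- (sumR_filter X u l').
  apply sumR_perm, NoDup_Permutation; try now apply NoDup_filter.
  intro x. rewrite !filter_In, !dec_in_true. split; intros [_ Hx]; split; auto;
    apply NNPP; intro N; apply Hx; auto.
Qed.

Lemma sumR_pos (X : Type) (u : X -> R) (l : list X) : (forall x, 0 <= u x) ->
  0 <= sumR u l /\ forall x, In x l -> u x <= sumR u l.
Proof.
  intro H. induction l as [|a l [IH1 IH2]]; cbn; [split; [lra | intros x []]|].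
  specialize (H a) as Ha. split; [lra|]. intros x [<- | Hx]; [lra|]. specialize (IH2 x Hx). lra.
Qed.

Lemma supported_incl (X : Type) (u : X -> R) (l l' : list X) :
  (forall x, In x l -> In x l') -> supported u l -> supported u l'.
Proof. intros H Hs x Hx. apply Hs. auto. Qed.

Lemma supported_In (X : Type) (u : X -> R) (l : list X) (x : X) : supported u l -> 0 < u x -> In x l.
Proof. intros H Hx. apply NNPP. intro N. apply H in N. lra. Qed.

Lemma supported_enum (X : Type) (u : X -> R) (l : list X) (P : X -> Prop) :
  (forall x, 0 <= u x) -> (forall x, 0 < u x -> P x) -> supported u l -> supported u (enum X P l).
Proof.
  intros Hpos HP Hs x Hx. destruct (Rlt_dec 0 (u x)) as [H | H].
  - exfalso. apply Hx. apply enum_In. split; [now apply supported_In with u | auto].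
  - specialize (Hpos x). lra.
Qed.

(** The list is quantified inside, so that the total mass depends on the function alone and can be
    computed on any convenient list. *)
Definition total (X : Type) (u : X -> R) : R :=
  epsilon (inhabits 0) (fun v => exists l, NoDup l /\ supported u l /\ v = sumR u l).

Lemma total_eq (X : Type) (u : X -> R) (l : list X) : NoDup l -> supported u l -> total X u = sumR u l.
Proof.
  intros H Hs. unfold total.
  destruct (epsilon_spec (inhabits 0) (fun v => exists l, NoDup l /\ supported u l /\ v = sumR u l))
    as [l' [H' [Hs' ->]]].
  - now exists (sumR u l), l.
  - now apply sumR_supported.
Qed.

Definition normalized (X : Type) (u : X -> R) (x : X) : R := u x / total X u.

Lemma normalized_lim (X Z : Type) (F : (Z -> Prop) -> Prop) (L : list X) (u : Z -> X -> R) (u0 : X -> R) :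
  is_filter Z F -> F (fun z => supported (u z) L) -> supported u0 L -> 0 < total X u0 ->
  (forall x, lim Z F (fun z => u z x) (u0 x)) ->
  forall x, lim Z F (fun z => normalized X (u z) x) (normalized X u0 x).
Proof.
  intros HF HL H0 Hpos H x. unfold normalized. apply lim_div; auto.
  assert (HN : NoDup (nodup (dec_eq X) L)) by apply NoDup_nodup.
  assert (HI : forall y, In y L -> In y (nodup (dec_eq X) L)) by (intro y; apply nodup_In).
  rewrite (total_eq X u0 (nodup (dec_eq X) L)); [|exact HN | now apply supported_incl with L].
  apply (lim_ext_loc Z F HF (fun z => sumR (u z) (nodup (dec_eq X) L))).
  - eapply (filt_imp _ _ HF). 2: exact HL. cbn. intros z Hz. symmetry. apply total_eq; [exact HN|].
    now apply supported_incl with L.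
  - now apply lim_sumR.
Qed.

Section Rips.
Context (X : Type) (d : X -> X -> R) (C : X -> Prop) (r : R).

Notation Rips := (rips_top d C r).

(** A nonzero point of the cone over some simplex. Working before normalization lets later
    constructions add and scale weights freely. *)
Definition carried (u : X -> R) : Prop :=
  (forall x, 0 <= u x) /\ (exists x, 0 < u x) /\ exists l, rips_simplex d C r l /\ supported u l.

Lemma carried_total (u : X -> R) : carried u -> 0 < total X u.
Proof.
  intros [Hpos [[x Hx] [l [[HN _] Hs]]]]. rewrite (total_eq X u l HN Hs).
  destruct (sumR_pos X u l Hpos) as [_ H]. specialize (H x (supported_In X u l x Hs Hx)). lra.
Qed.

Lemma normalized_point (u : X -> R) : carried u -> rips_point d C r (normalized X u).
Proof.
  intro H. generalize (carried_total u H). destruct H as [Hpos [Hex [l [Hl Hs]]]]. intro Ht.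
  split.
  - intro x. apply Rmult_le_pos; [apply Hpos|]. left. now apply Rinv_0_lt_compat.
  - exists l. split; [exact Hl|]. split.
    + intros x Hx. unfold normalized. rewrite Hs by exact Hx. unfold Rdiv. ring.
    + transitivity (sumR (fun x => / total X u * u x) l).
      * apply sumR_ext. intros x _. unfold normalized, Rdiv. ring.
      * rewrite sumR_scal. destruct Hl as [HN _]. rewrite <- (total_eq X u l HN Hs). field. lra.
Qed.

Definition realize (u : X -> R) (H : carried u) : pt Rips :=
  exist _ (normalized X u) (normalized_point u H).

Lemma rips_pt_ext (p q : pt Rips) : (forall x, proj1_sig p x = proj1_sig q x) -> p = q.
Proof.
  destruct p as [p Hp], q as [q Hq]. cbn. intro H.
  assert (E : p = q) by now apply functional_extensionality. subst q.
  f_equal. apply proof_irrelevance.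
Qed.

Lemma rips_pt_pos (p : pt Rips) (x : X) : 0 <= proj1_sig p x.
Proof. destruct p as [p [Hp H]]. apply Hp. Qed.

Lemma rips_pt_simplex (p : pt Rips) : exists l, rips_simplex d C r l /\ supported (proj1_sig p) l.
Proof. destruct p as [p [Hp [l [H1 [H2 H3]]]]]. now exists l. Qed.

Lemma rips_pt_total (p : pt Rips) : total X (proj1_sig p) = 1.
Proof.
  destruct p as [p [Hp [l [H1 [H2 H3]]]]]. cbn. rewrite <- H3. apply total_eq; [apply H1 | exact H2].
Qed.

Lemma rips_pt_vertex (p : pt Rips) : exists v, 0 < proj1_sig p v /\ forall x, proj1_sig p x <= proj1_sig p v.
Proof.
  destruct p as [p [Hp [l [H1 [H2 H3]]]]]. cbn.
  destruct (list_argmax X p l) as [v [Hv Hm]].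
  { intro E. rewrite E in H3. cbn in H3. lra. }
  assert (Hpos : exists x, 0 < p x).
  { apply NNPP. intro N. assert (E : sumR p l = sumR (fun x => 0 * p x) l).
    { apply sumR_ext. intros x _. assert (~ 0 < p x) by (intro; apply N; now exists x).
      specialize (Hp x). lra. }
    rewrite sumR_scal in E. lra. }
  destruct Hpos as [x Hx]. exists v. split.
  - specialize (Hm x (supported_In X p l x H2 Hx)). lra.
  - intro y. destruct (classic (In y l)) as [Hy | Hy]; [auto|]. rewrite (H2 y Hy). apply Hp.
Qed.

Lemma realize_scaled (p : pt Rips) (c : R) (u : X -> R) (H : carried u) : 0 < c ->
  (forall x, u x = c * proj1_sig p x) -> realize u H = p.
Proof.
  intros Hc Hu. apply rips_pt_ext. intro x. cbn. unfold normalized.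
  destruct (rips_pt_simplex p) as [l [[HN _] Hs]].
  rewrite (total_eq X u l HN), Hu.
  - rewrite (sumR_ext X u (fun x => c * proj1_sig p x) l), sumR_scal by auto.
    rewrite <- (total_eq X (proj1_sig p) l HN Hs), rips_pt_total. field. lra.
  - intros y Hy. rewrite Hu, Hs by exact Hy. ring.
Qed.

Lemma realize_ext (u v : X -> R) (Hu : carried u) (Hv : carried v) :
  (forall x, u x = v x) -> realize u Hu = realize v Hv.
Proof.
  intro H. assert (E : u = v) by now apply functional_extensionality. subst v.
  f_equal. apply proof_irrelevance.
Qed.

(** [L] need not be a simplex. Near [p0] the support of [p z] contains that of [p0], so both points
    lie in the closed simplex spanned by the support of [p z]. Only finitely many such simplices
    have their vertices in [L], and [V] is relatively open in each. *)
Lemma rips_lim (Z : Type) (F : (Z -> Prop) -> Prop) (L : list X) (p : Z -> pt Rips) (p0 : pt Rips)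
    (V : pt Rips -> Prop) :
  is_filter Z F -> F (fun z => supported (proj1_sig (p z)) L) -> supported (proj1_sig p0) L ->
  (forall x, lim Z F (fun z => proj1_sig (p z) x) (proj1_sig p0 x)) ->
  op Rips V -> V p0 -> F (fun z => V (p z)).
Proof.
  intros HF HL H0 Hlim HV Hp0.
  assert (Hsupp : F (fun z => forall x, In x L -> 0 < proj1_sig p0 x -> 0 < proj1_sig (p z) x)).
  { apply filt_list; [exact HF|]. intros x _. destruct (Rlt_dec 0 (proj1_sig p0 x)) as [H | H].
    - apply (filt_imp _ _ HF (fun z => 0 < proj1_sig (p z) x)); [auto|].
      now apply (lim_gt Z F HF _ (proj1_sig p0 x)).
    - apply filt_all; [exact HF|]. intros z Hx. contradiction. }
  assert (Hfaces : F (fun z => forall T, In T (subsets X L) -> rips_simplex d C r (enum X T L) ->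
     supported (proj1_sig p0) (enum X T L) -> supported (proj1_sig (p z)) (enum X T L) -> V (p z))).
  { apply filt_list; [exact HF|]. intros T _.
    destruct (classic (rips_simplex d C r (enum X T L) /\ supported (proj1_sig p0) (enum X T L)))
      as [[H1 H2] | N].
    - destruct (HV (enum X T L) H1 p0 Hp0 H2) as [e [He H]].
      eapply (filt_imp _ _ HF). 2: exact (filt_list Z F HF X (enum X T L) (fun x z =>
        Rabs (proj1_sig (p z) x - proj1_sig p0 x) < e) (fun x _ => Hlim x e He)).
      cbn. intros z Hz _ _ Hs. now apply H.
    - apply filt_all; [exact HF|]. intros z H1 H2. exfalso. tauto. }
  eapply (filt_imp _ _ HF). 2: exact (filt_and _ _ HF _ _ HL (filt_and _ _ HF _ _ Hsupp Hfaces)).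
  cbn. intros z [H1 [H2 H3]].
  assert (HTL : forall x, 0 < proj1_sig (p z) x -> In x L) by (intro x; now apply supported_In).
  apply (H3 (fun x => 0 < proj1_sig (p z) x)).
  - now apply subsets_spec.
  - destruct (rips_pt_simplex (p z)) as [l [[_ [HC Hd]] Hs]].
    assert (Hin : forall x, In x (enum X (fun x => 0 < proj1_sig (p z) x) L) -> In x l).
    { intros x Hx. apply enum_In in Hx. apply supported_In with (proj1_sig (p z)); tauto. }
    split; [apply enum_NoDup|]. split.
    + intros x Hx. auto.
    + intros x y Hx Hy. apply Hd; auto.
  - apply supported_enum; auto; [apply rips_pt_pos|].
    intros x Hx. apply H2; [now apply supported_In with (proj1_sig p0) | exact Hx].
  - apply supported_enum; auto. apply rips_pt_pos.
Qed.

Definition simplex_nbhd (l : list X) (p : pt Rips) (P : pt Rips -> Prop) : Prop :=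
  exists e, 0 < e /\ forall q, supported (proj1_sig q) l ->
    (forall x, In x l -> Rabs (proj1_sig q x - proj1_sig p x) < e) -> P q.

Definition with_time (Y : Type) (N : (Y -> Prop) -> Prop) (s : I01) (P : Y * I01 -> Prop) : Prop :=
  exists e, 0 < e /\ N (fun y => forall s' : I01, Rabs (proj1_sig s' - proj1_sig s) < e -> P (y, s')).

Lemma simplex_nbhd_filter (l : list X) (p : pt Rips) : is_filter _ (simplex_nbhd l p).
Proof.
  split.
  - exists 1. split; [lra | auto].
  - intros P Q [e [He HP]] [e' [He' HQ]]. exists (Rmin e e'). split; [now apply Rmin_pos|].
    intros q Hq H. split; [apply HP | apply HQ]; auto; intros x Hx; specialize (H x Hx);
      generalize (Rmin_l e e') (Rmin_r e e'); lra.
  - intros P Q H [e [He HP]]. exists e. split; auto.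
Qed.

Lemma with_time_filter (Y : Type) (N : (Y -> Prop) -> Prop) (s : I01) :
  is_filter Y N -> is_filter _ (with_time Y N s).
Proof.
  intro HN. split.
  - exists 1. split; [lra|]. apply filt_all; auto.
  - intros P Q [e [He HP]] [e' [He' HQ]]. exists (Rmin e e'). split; [now apply Rmin_pos|].
    eapply (filt_imp _ _ HN). 2: exact (filt_and _ _ HN _ _ HP HQ). cbn. intros y [H1 H2] s' Hs.
    generalize (Rmin_l e e') (Rmin_r e e'); intros. split; [apply H1 | apply H2]; lra.
  - intros P Q H [e [He HP]]. exists e. split; [exact He|].
    eapply (filt_imp _ _ HN). 2: exact HP. cbn. auto.
Qed.

Lemma with_time_fst (Y : Type) (N : (Y -> Prop) -> Prop) (s : I01) (P : Y -> Prop) :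
  is_filter Y N -> N P -> with_time Y N s (fun z => P (fst z)).
Proof. intros HN H. exists 1. split; [lra|]. eapply (filt_imp _ _ HN). 2: exact H. cbn. auto. Qed.

Lemma with_time_snd (Y : Type) (N : (Y -> Prop) -> Prop) (s : I01) :
  is_filter Y N -> lim _ (with_time Y N s) (fun z => proj1_sig (snd z)) (proj1_sig s).
Proof. intros HN e He. exists e. split; [exact He|]. apply filt_all; auto. Qed.

Lemma simplex_nbhd_supported (l : list X) (p : pt Rips) :
  simplex_nbhd l p (fun q => supported (proj1_sig q) l).
Proof. exists 1. split; [lra | auto]. Qed.

Lemma simplex_nbhd_lim (l : list X) (p : pt Rips) : supported (proj1_sig p) l ->
  unif_lim _ X (simplex_nbhd l p) (fun q => proj1_sig q) (proj1_sig p).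
Proof.
  intros Hp e He. exists e. split; [exact He|]. intros q Hq H x.
  destruct (classic (In x l)) as [Hx | Hx].
  - specialize (H x Hx). lra.
  - rewrite (Hp x Hx), (Hq x Hx), Rminus_diag, Rabs_R0. lra.
Qed.

Lemma continuous_from_rips (B : TopSp) (f : pt Rips -> pt B) :
  (forall l p V, rips_simplex d C r l -> supported (proj1_sig p) l -> op B V -> V (f p) ->
     simplex_nbhd l p (fun q => V (f q))) ->
  continuous Rips B f.
Proof. intros H V HV l Hl p Hp Hs. now apply H. Qed.

(* Since [0, 1] is compact, the product with it carries the weak topology of the closed cells. *)
Lemma continuous_from_rips_I (B : TopSp) (H : pt (prodI Rips) -> pt B) :
  (forall l p s V, rips_simplex d C r l -> supported (proj1_sig p) l -> op B V -> V (H (p, s)) ->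
     with_time _ (simplex_nbhd l p) s (fun z => V (H z))) ->
  continuous (prodI Rips) B H.
Proof.
  intros HH V HV [p s] Hps. cbn in Hps |- *.
  destruct (rips_pt_simplex p) as [l0 [Hl0 Hs0]].
  destruct (HH l0 p s V Hl0 Hs0 HV Hps) as [e0 [He0 [e1 [He1 H0]]]].
  (* Tube construction: keep the points [q] whose whole closed interval of times lands in [V]. The
     interval is compact, and halving [e0] keeps it inside the range controlled at [p]. *)
  exists (fun q => forall s' : I01, Rabs (proj1_sig s' - proj1_sig s) <= e0 / 2 -> V (H (q, s'))), (e0 / 2).
  repeat split.
  - intros l Hl q Hq Hql.
    assert (Hrad : forall x, exists e : posreal, forall s1 : I01, proj1_sig s1 = x ->
      Rabs (x - proj1_sig s) <= e0 / 2 -> forall q', supported (proj1_sig q') l ->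
      (forall y, In y l -> Rabs (proj1_sig q' y - proj1_sig q y) < e) ->
      forall s2 : I01, Rabs (proj1_sig s2 - x) < e -> V (H (q', s2))).
    { intro x. destruct (classic (exists s1 : I01, proj1_sig s1 = x /\ Rabs (x - proj1_sig s) <= e0 / 2))
        as [[s1 [E1 Hx]] | N].
      - subst x. destruct (HH l q s1 V Hl Hql HV (Hq s1 Hx)) as [e [He [e' [He' H1]]]].
        exists (mkposreal (Rmin e e') (Rmin_pos _ _ He He')). cbn.
        generalize (Rmin_l e e') (Rmin_r e e'). intros L1 L2 s3 E3 _ q' Hq' Hd s2 Hs2.
        apply H1; auto; [|lra]. intros y Hy. specialize (Hd y Hy). lra.
      - exists (mkposreal 1 Rlt_0_1). intros s1 E1 Hx. exfalso. apply N. now exists s1. }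
    set (rad := fun x => proj1_sig (constructive_indefinite_description _ (Hrad x))).
    set (a := Rmax 0 (proj1_sig s - e0 / 2)). set (b := Rmin 1 (proj1_sig s + e0 / 2)).
    (* A common radius: every time in [a, b] is within [rad t] of some [t] with [e <= rad t]. The
       existence of [t] comes doubly negated, whence the classical step below. *)
    destruct (Compactness.compactness_value_1d a b rad) as [e Hcov].
    exists e. split; [apply cond_pos|]. intros q' Hq' Hd s' Hs'.
    apply NNPP. intro N. apply (Hcov (proj1_sig s')).
    { apply Rabs_le_bounds in Hs'. destruct (proj2_sig s'). split.
      - apply Rmax_lub; lra.
      - apply Rmin_glb; lra. }
    intros [t [[Ht1 Ht2] [Ht3 Ht4]]]. apply N. clear N.
    assert (Ht : 0 <= t <= 1).
    { split; [apply Rle_trans with a; [apply Rmax_l | exact Ht1]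
             | apply Rle_trans with b; [exact Ht2 | apply Rmin_l]]. }
    assert (Hts : Rabs (t - proj1_sig s) <= e0 / 2).
    { apply Rabs_le. generalize (Rmax_r 0 (proj1_sig s - e0 / 2)) (Rmin_r 1 (proj1_sig s + e0 / 2)).
      fold a b. lra. }
    unfold rad in Ht3, Ht4. destruct (constructive_indefinite_description _ (Hrad t)) as [e2 He2].
    cbn in Ht3, Ht4. apply (He2 (exist _ t Ht) eq_refl Hts); auto.
    intros y Hy. specialize (Hd y Hy). lra.
  - intros s' Hs'. apply H0; auto.
    + intros x _. rewrite Rminus_diag, Rabs_R0. exact He1.
    + lra.
  - lra.
  - intros q s' Hq Hs'. apply Hq. lra.
Qed.

End Rips.

(** * Compact metric spaces *)

Lemma unif_lim_finite (Z J : Type) (F : (Z -> Prop) -> Prop) (w : Z -> J -> R) (w0 : J -> R) (L : list J) :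
  is_filter Z F -> F (fun z => supported (w z) L) -> supported w0 L ->
  (forall j, lim Z F (fun z => w z j) (w0 j)) -> unif_lim Z J F w w0.
Proof.
  intros HF HL H0 H e He.
  eapply (filt_imp _ _ HF). 2: exact (filt_and _ _ HF _ _ HL (filt_list Z F HF J L
    (fun j z => Rabs (w z j - w0 j) < e) (fun j _ => H j e He))).
  cbn. intros z [H1 H2] j. destruct (classic (In j L)) as [Hj | Hj].
  - specialize (H2 j Hj). lra.
  - rewrite (H1 j Hj), (H0 j Hj), Rminus_diag, Rabs_R0. lra.
Qed.

Section Metric.
Context (X : Type) (d : X -> X -> R) (Hd : is_metric d).

Lemma dist_self (x : X) : d x x = 0.
Proof. now apply Hd. Qed.

Lemma dist_sym (x y : X) : d x y = d y x.
Proof. apply Hd. Qed.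

Lemma dist_tri (x y z : X) : d x z <= d x y + d y z.
Proof. apply Hd. Qed.

Definition near (x : X) (P : X -> Prop) : Prop := exists e, 0 < e /\ forall y, d x y < e -> P y.

Lemma near_filter (x : X) : is_filter X (near x).
Proof.
  split.
  - exists 1. split; [lra | auto].
  - intros P Q [e [He HP]] [e' [He' HQ]]. exists (Rmin e e'). split; [now apply Rmin_pos|].
    intros y Hy. generalize (Rmin_l e e') (Rmin_r e e'); intros.
    split; [apply HP | apply HQ]; lra.
  - intros P Q H [e [He HP]]. exists e. split; auto.
Qed.

Lemma near_id (x : X) : metric_lim X X d (near x) (fun y => y) x.
Proof. intros e He. now exists e. Qed.

Lemma ball_open (x : X) (e : R) : op (metric_top d) (fun y => d x y < e).
Proof.
  intros y Hy. cbn in y. exists (e - d x y). split; [lra|]. intros z Hz.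
  generalize (dist_tri x y z). lra.
Qed.

Lemma dist_lim (Z : Type) (F : (Z -> Prop) -> Prop) (y : Z -> X) (y0 c : X) :
  is_filter Z F -> metric_lim X Z d F y y0 -> lim Z F (fun z => d c (y z)) (d c y0).
Proof.
  intros HF H e He. eapply (filt_imp _ _ HF). 2: exact (H e He). cbn. intros z Hz.
  generalize (dist_tri c y0 (y z)) (dist_tri c (y z) y0). rewrite (dist_sym (y z) y0). intros.
  apply Rabs_def1; lra.
Qed.

Lemma continuous_from_metric (B : TopSp) (f : X -> pt B) :
  (forall x V, op B V -> V (f x) -> near x (fun y => V (f y))) -> continuous (metric_top d) B f.
Proof. intros H V HV x Hx. now apply H. Qed.

Lemma continuous_from_metric_I (B : TopSp) (H : pt (prodI (metric_top d)) -> pt B) :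
  (forall x s V, op B V -> V (H (x, s)) -> with_time X (near x) s (fun z => V (H z))) ->
  continuous (prodI (metric_top d)) B H.
Proof.
  intros HH V HV [x s] Hx. destruct (HH x s V HV Hx) as [e [He [e1 [He1 H1]]]].
  exists (fun y => d x y < e1), e. cbn. split; [apply ball_open|].
  split; [rewrite dist_self; exact He1|]. split; auto.
Qed.

Lemma finite_net (D : X -> Prop) (e : R) : compact_metric d -> 0 < e ->
  (forall x, exists c, D c /\ d c x < e) ->
  exists l, (forall c, In c l -> D c) /\ forall x, exists c, In c l /\ d c x < e.
Proof.
  intros Hc He HD.
  destruct (Hc (fun W => exists c, D c /\ W = fun y => d c y < e)) as [l [Hl Hcov]].
  - intros W [c [_ ->]]. apply ball_open.
  - intro x. destruct (HD x) as [c [H1 H2]]. exists (fun y => d c y < e). split; [now exists c | exact H2].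
  - assert (H : exists l', (forall c, In c l' -> D c) /\
      forall x, (exists W, In W l /\ W x) -> exists c, In c l' /\ d c x < e).
    { clear Hcov. induction Hl as [|W l [c [Hc1 ->]] _ [l' [IH1 IH2]]].
      - exists nil. split; [intros c []|]. intros x [W [[] _]].
      - exists (c :: l'). split.
        + intros c' [<- | H']; auto.
        + intros x [W [[<- | HW] Hx]].
          * exists c. split; [now left | exact Hx].
          * destruct (IH2 x) as [c' [H1 H2]]; [now exists W|]. exists c'. split; [now right | exact H2]. }
    destruct H as [l' [H1 H2]]. exists l'. split; auto.
Qed.

Lemma lebesgue_number (U : (X -> Prop) -> Prop) : compact_metric d -> open_cover d U ->
  exists e, 0 < e /\ forall x, exists V, U V /\ forall y, d x y < e -> V y.
Proof.
  intros Hc [Hop Hcov].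
  (* Balls whose doubles lie in a member of [U]: the ball of radius [e] about any point of such a
     ball stays in that member. *)
  destruct (Hc (fun W => exists c e, 0 < e /\ (exists V, U V /\ forall y, d c y < 2 * e -> V y) /\
                W = fun y => d c y < e)) as [l [Hl Hcov']].
  - intros W [c [e [_ [_ ->]]]]. apply ball_open.
  - intro x. destruct (Hcov x) as [V [HV Hx]]. destruct (Hop V HV x Hx) as [e [He Hb]].
    exists (fun y => d x y < e / 2). split.
    + exists x, (e / 2). split; [lra|]. split; [|reflexivity]. exists V. split; [exact HV|].
      intros y Hy. apply Hb. lra.
    + rewrite dist_self. lra.
  - assert (H : exists e, 0 < e /\ forall x, (exists W, In W l /\ W x) ->
       exists V, U V /\ forall y, d x y < e -> V y).
    { clear Hcov'. induction Hl as [|W l [c [e [He [[V [HV Hb]] ->]]]] _ [e' [He' IH]]].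
      - exists 1. split; [lra|]. intros x [W [[] _]].
      - exists (Rmin e e'). split; [now apply Rmin_pos|].
        generalize (Rmin_l e e') (Rmin_r e e'). intros L1 L2 x [W [[<- | HW] Hx]].
        + exists V. split; [exact HV|]. intros y Hy. apply Hb. generalize (dist_tri c x y). lra.
        + destruct (IH x) as [V' [HV' Hb']]; [now exists W|]. exists V'. split; [exact HV'|].
          intros y Hy. apply Hb'. lra. }
    destruct H as [e [He H]]. exists e. split; auto.
Qed.

Lemma countable_dense : compact_metric d ->
  exists C : X -> Prop, countable C /\ forall x e, 0 < e -> exists c, C c /\ d x c < e.
Proof.
  intro Hc.
  assert (Hnet : forall n : nat, exists l : list X, forall x, exists c, In c l /\ d c x < / (INR n + 1)).
  { intro n. assert (He : 0 < / (INR n + 1)).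
    { apply Rinv_0_lt_compat. generalize (pos_INR n). lra. }
    destruct (finite_net (fun _ => True) (/ (INR n + 1)) Hc He) as [l [_ Hl]].
    - intro x. exists x. rewrite dist_self. split; [exact I | exact He].
    - now exists l. }
  set (net := fun n => proj1_sig (constructive_indefinite_description _ (Hnet n))).
  assert (Hn : forall n x, exists c, In c (net n) /\ d c x < / (INR n + 1)).
  { intro n. exact (proj2_sig (constructive_indefinite_description _ (Hnet n))). }
  exists (fun x => exists n, In x (net n)). split.
  (* A point is coded by the number of a net and a position in its list; the code determines the
     point, which gives injectivity. *)
  - assert (Hcode : forall a : {x | exists n, In x (net n)}, exists k : nat,
      nth_error (net (fst (Cantor.of_nat k))) (snd (Cantor.of_nat k)) = Some (proj1_sig a)).
    { intros [x [n Hx]]. destruct (In_nth_error _ _ Hx) as [i Hi].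
      exists (Cantor.to_nat (n, i)). rewrite Cantor.cancel_of_to. exact Hi. }
    exists (fun a => proj1_sig (constructive_indefinite_description _ (Hcode a))).
    intros a b. destruct (constructive_indefinite_description _ (Hcode a)) as [i Hi].
    destruct (constructive_indefinite_description _ (Hcode b)) as [j Hj]. cbn. intros ->.
    rewrite Hi in Hj. injection Hj. intro E. destruct a as [a Ha], b as [b Hb]. cbn in E. subst b.
    f_equal. apply proof_irrelevance.
  - intros x e He. destruct (archimed_cor1 e He) as [n [Hn1 Hn2]].
    destruct (Hn n x) as [c [H1 H2]]. exists c. split; [now exists n|]. rewrite dist_sym.
    apply Rlt_trans with (1 := H2). apply Rlt_trans with (2 := Hn1).
    apply lt_0_INR in Hn2. apply Rinv_lt_contravar; nra.
Qed.

Lemma open_list (l : list (X -> Prop)) (x : X) :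
  (forall V, In V l -> op (metric_top d) V) -> (forall V, In V l -> V x) ->
  near x (fun y => forall V, In V l -> V y).
Proof.
  intros H Hx. apply filt_list; [apply near_filter|]. intros V HV. now apply H; [|apply Hx].
Qed.

Lemma contractible_contraction (P : X -> Prop) :
  contractible (subsp (metric_top d) P) -> exists h, contraction X d P h.
Proof.
  intros [x0 [H [Hc Hh]]]. cbn in H.
  (* Off [P] and off [0, 1] the value [x] is only a default. *)
  set (h := fun x s => match excluded_middle_informative (P x) with
                       | left Hx => match excluded_middle_informative (0 <= s <= 1) with
                                    | left Hs => proj1_sig (H (exist _ x Hx, exist _ s Hs))
                                    | right _ => x end
                       | right _ => x end).
  assert (Eh : forall x s (Hx : P x) (Hs : 0 <= s <= 1), h x s = proj1_sig (H (exist _ x Hx, exist _ s Hs))).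
  { intros x s Hx Hs. unfold h. destruct excluded_middle_informative as [Hx' | N]; [|contradiction].
    destruct excluded_middle_informative as [Hs' | N]; [|contradiction].
    now rewrite (proof_irrelevance _ Hx' Hx), (proof_irrelevance _ Hs' Hs). }
  assert (E1 : forall x, P x -> h x 1 = proj1_sig x0).
  { intros x Hx. rewrite (Eh x 1 Hx I1_pf).
    exact (f_equal (@proj1_sig X P) (proj2 (Hh (exist _ x Hx)))). }
  exists h. split.
  - intros x s Hx Hs. rewrite (Eh x s Hx Hs). apply proj2_sig.
  - intros x Hx. rewrite (Eh x 0 Hx I0_pf).
    exact (f_equal (@proj1_sig X P) (proj1 (Hh (exist _ x Hx)))).
  - intros x y Hx Hy. now rewrite !E1.
  - intros x s e Hx Hs He.
    destruct (Hc (fun b => d (h x s) (proj1_sig b) < e)) with (p := (exist P x Hx, exist (fun s => 0 <= s <= 1) s Hs))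
      as [W [e1 [HW [Wx [He1 HH]]]]].
    + exists (fun y => d (h x s) y < e). split; [apply ball_open | tauto].
    + rewrite (Eh x s Hx Hs), dist_self. exact He.
    + destruct HW as [W' [HW' EW]]. cbn in Wx. destruct (HW' x (proj1 (EW _) Wx)) as [e2 [He2 Hb]].
      cbn in Hb. exists (Rmin e1 e2). split; [now apply Rmin_pos|].
      generalize (Rmin_l e1 e2) (Rmin_r e1 e2). intros L1 L2 y t Hy Ht Hdxy Hts.
      rewrite (Eh y t Hy Ht). apply HH.
      * apply EW. apply Hb. cbn. lra.
      * cbn. lra.
Qed.

End Metric.

(** * The two maps *)

Lemma lim_Rmin (Z : Type) (F : (Z -> Prop) -> Prop) (u v : Z -> R) (a b : R) : is_filter Z F ->
  lim Z F u a -> lim Z F v b -> lim Z F (fun z => Rmin (u z) (v z)) (Rmin a b).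
Proof.
  intros HF Hu Hv e He. eapply (filt_imp _ _ HF). 2: exact (filt_and _ _ HF _ _ (Hu e He) (Hv e He)).
  cbn. intros z [H1 H2]. apply Rabs_def2 in H1, H2. unfold Rmin.
  destruct (Rle_dec (u z) (v z)), (Rle_dec a b); apply Rabs_def1; lra.
Qed.

Section Coord.
Context (X I : Type) (pick : (I -> Prop) -> X).

(** Several sets may be sent to the same vertex [c]. Their gaps will be combined by a supremum
    instead of a sum: the support is the same, and continuity follows from the Lipschitz bound on
    gaps. *)
Definition coord_term (w : I -> R) (c : X) (S : I -> Prop) : R :=
  if dec_eq X c (pick S) then gap I w S else 0.

(* Unnormalized barycentric coordinates of the image of [w] under the simplicial map of the
   barycentric subdivision that sends the vertex [S] to [pick S]. *)
Definition coord (w : I -> R) (c : X) : R := supf (I -> Prop) (coord_term w c).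

Lemma coord_term_bounded (w : I -> R) (c : X) : bounded I w -> bounded (I -> Prop) (coord_term w c).
Proof.
  intro H. destruct (gap_bounded I w H) as [B HB]. exists (Rmax 0 B). intro S. unfold coord_term.
  destruct dec_eq; [eapply Rle_trans; [apply HB | apply Rmax_r] | apply Rmax_l].
Qed.

Lemma coord_nonneg (w : I -> R) (c : X) : bounded I w -> 0 <= coord w c.
Proof. intro H. now apply supf_nonneg, coord_term_bounded. Qed.

Lemma coord_active (w : I -> R) (c : X) : 0 < coord w c -> exists S, active I w S /\ c = pick S.
Proof.
  intro H. apply NNPP. intro N. assert (coord w c <= 0); [|lra].
  apply supf_le; [lra|]. intro S. unfold coord_term. destruct dec_eq as [E | E]; [|lra].
  apply Rnot_lt_le. intro Ha. apply N. now exists S.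
Qed.

Lemma active_coord (w : I -> R) (S : I -> Prop) : bounded I w -> active I w S -> 0 < coord w (pick S).
Proof.
  intros Hb H. apply Rlt_le_trans with (coord_term w (pick S) S).
  - unfold coord_term. destruct dec_eq as [E | E]; [exact H | now contradiction E].
  - now apply supf_ge, coord_term_bounded.
Qed.

Lemma coord_supported (w : I -> R) (L : list I) : supported w L ->
  supported (coord w) (map pick (subsets I L)).
Proof.
  intros Hs c Hc. apply Rle_antisym.
  - apply Rnot_lt_le. intro H. destruct (coord_active w c H) as [S [HS ->]].
    apply Hc, in_map, subsets_spec. now apply active_supp with w.
  - apply coord_nonneg. now apply supported_bounded with L.
Qed.

Lemma coord_lim (Z : Type) (F : (Z -> Prop) -> Prop) (w : Z -> I -> R) (w0 : I -> R) (c : X) :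
  is_filter Z F -> bounded I w0 -> unif_lim Z I F w w0 -> lim Z F (fun z => coord (w z) c) (coord w0 c).
Proof.
  intros HF Hb Hw. apply lim_supf; [exact HF | now apply coord_term_bounded|].
  apply (unif_lim_lip Z F HF I (I -> Prop) w w0) with 2; [lra | | exact Hw].
  intros z e He H S. unfold coord_term. destruct dec_eq; [now apply gap_lip|].
  rewrite Rminus_diag, Rabs_R0. lra.
Qed.

End Coord.

(** * Truncated weights on simplices *)

Section Clip.
Context (X : Type).

Definition max_weight (u : X -> R) : R := supf (X -> Prop) (gap X u).

(* Truncation at half the maximum: every index of weight at least half the maximum becomes
   maximal, hence belongs to all active sets. *)
Definition clip (u : X -> R) (s : X -> Prop) : R := Rmin (max_weight u / 2) (gap X u s).

Lemma gap_supported (u : X -> R) (l : list X) : supported u l -> supported (gap X u) (subsets X l).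
Proof.
  intros Hs s Hn. apply Rle_antisym; [|apply gap_nonneg].
  apply Rnot_lt_le. intro H. apply Hn, subsets_spec. now apply active_supp with u.
Qed.

Lemma max_weight_nonneg (u : X -> R) (l : list X) : supported u l -> 0 <= max_weight u.
Proof. intro Hs. apply supf_nonneg, gap_bounded. now apply supported_bounded with l. Qed.

Lemma max_weight_attained (u : X -> R) (l : list X) : supported u l -> (forall x, 0 <= u x) ->
  (exists x, 0 < u x) -> exists s, gap X u s = max_weight u /\ 0 < gap X u s.
Proof.
  intros Hs Hpos Hex. apply supf_attained with (subsets X l); [now apply gap_supported|].
  exists (fun x => 0 < u x). now apply active_support with l.
Qed.

Lemma clip_nonneg (u : X -> R) (l : list X) (s : X -> Prop) : supported u l -> 0 <= clip u s.
Proof.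
  intro Hs. generalize (max_weight_nonneg u l Hs). intro.
  apply Rmin_glb; [lra | apply gap_nonneg].
Qed.

Lemma clip_active (u : X -> R) (s : X -> Prop) : 0 < clip u s -> active X u s.
Proof. intro H. eapply Rlt_le_trans; [exact H | apply Rmin_r]. Qed.

Lemma clip_supported (u : X -> R) (l : list X) (L : list (X -> Prop)) : supported u l ->
  (forall s, active X u s -> In s L) -> supported (clip u) L.
Proof.
  intros Hs HL s Hn. apply Rle_antisym; [|now apply clip_nonneg with l].
  apply Rnot_lt_le. intro H. apply Hn, HL. now apply clip_active.
Qed.

Lemma clip_pos (u : X -> R) (l : list X) : supported u l -> (forall x, 0 <= u x) ->
  (exists x, 0 < u x) -> exists s, 0 < clip u s.
Proof.
  intros Hs Hpos Hex. destruct (max_weight_attained u l Hs Hpos Hex) as [s [E H]].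
  exists s. unfold clip. rewrite <- E. apply Rmin_glb_lt; lra.
Qed.

Lemma clip_max (u : X -> R) (s : X -> Prop) : max_weight u / 2 <= gap X u s -> forall s', clip u s' <= clip u s.
Proof.
  intros H s'. unfold clip. rewrite (Rmin_left _ _ H). apply Rmin_l.
Qed.

Lemma max_weight_lim (Z : Type) (F : (Z -> Prop) -> Prop) (u : Z -> X -> R) (u0 : X -> R) :
  is_filter Z F -> bounded X u0 -> unif_lim Z X F u u0 -> lim Z F (fun z => max_weight (u z)) (max_weight u0).
Proof. intros HF Hb Hu. apply lim_supf; [exact HF | now apply gap_bounded | now apply lim_gap]. Qed.

Lemma gap_lim_at (Z : Type) (F : (Z -> Prop) -> Prop) (u : Z -> X -> R) (u0 : X -> R) (s : X -> Prop) :
  is_filter Z F -> unif_lim Z X F u u0 -> lim Z F (fun z => gap X (u z) s) (gap X u0 s).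
Proof.
  intros HF Hu. apply (unif_lim_at Z F HF (X -> Prop) (fun z => gap X (u z))). now apply lim_gap.
Qed.

Lemma clip_lim (Z : Type) (F : (Z -> Prop) -> Prop) (u : Z -> X -> R) (u0 : X -> R) (l : list X) :
  is_filter Z F -> F (fun z => supported (u z) l) -> supported u0 l -> unif_lim Z X F u u0 ->
  unif_lim Z (X -> Prop) F (fun z => clip (u z)) (clip u0).
Proof.
  intros HF Hl H0 Hu.
  assert (HL : forall v, supported v l -> supported (clip v) (subsets X l)).
  { intros v Hv. apply clip_supported with l; [exact Hv|]. intros s Hs.
    apply subsets_spec. now apply active_supp with v. }
  apply unif_lim_finite with (subsets X l); [exact HF | | now apply HL|].
  - eapply (filt_imp _ _ HF). 2: exact Hl. cbn. auto.
  - intro s. apply lim_Rmin; [exact HF | | now apply gap_lim_at].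
    unfold Rdiv. apply lim_mult; [exact HF | | now apply lim_const].
    apply max_weight_lim; auto. now apply supported_bounded with l.
Qed.

End Clip.

(** * Cover sets, contractions and picked points assumed for the two maps *)

Section Maps.
Context (X : Type) (d : X -> X -> R) (Hd : is_metric d) (r : R) (U : (X -> Prop) -> Prop).
Context (HUopen : forall V, U V -> op (metric_top d) V).
Context (HUdiam : forall l : list X, (exists V, U V /\ forall x, In x l -> V x) -> diam_lt d l r).
Context (C : X -> Prop) (eta : R) (Heta : 0 < eta).
Context (Hleb : forall x, exists V, U V /\ forall y, d x y < 6 * eta -> V y).
Context (E : list X) (HE : forall x, exists c, In c E /\ d c x < eta).
Context (V : (X -> Prop) -> X -> Prop) (HVU : forall s, U (V s)).
Context (HVsimplex : forall s l, (forall x, s x -> In x l) -> diam_lt d l r -> forall x, s x -> V s x).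
(** Meant for the simplices carrying [to_rips x], whose vertices lie within [2 * eta] of [x]: their
    cover sets contain not only [x] but a ball about it of radius independent of [s], so one list of
    simplices can serve all points near [x]. *)
Context (HVsmall : forall s x y, (exists c, s c) -> (forall c, s c -> d x c < 2 * eta) -> d x y < eta -> V s y).
Context (K : ((X -> Prop) -> Prop) -> X -> R -> X).
Context (HK : forall S l, (forall s, S s -> In s l) -> (exists s, S s) ->
  (exists x, meet X (X -> Prop) V S x) -> contraction X d (meet X (X -> Prop) V S) (K S)).

(** Simplices with their cover sets and net points with their balls share one index type because the
    last homotopy moves weight from the first kind to the second. *)
Definition region (i : (X -> Prop) + X) (y : X) : Prop :=
  match i with inl s => V s y | inr c => d c y < eta end.

Context (pick : ((X -> Prop) + X -> Prop) -> X).
Context (Hpick : forall S l, (forall i, S i -> In i l) -> (exists y, forall i, S i -> region i y) ->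
  C (pick S) /\ forall i, S i -> region i (pick S)).
(** For sets of simplices with a suitable common vertex the picked point is itself a common vertex;
    this keeps the beginning of the blend inside the simplex of [p]. *)
Context (Hpick_common : forall S, (exists c, C c /\ forall i, S i -> region i c /\ exists s, i = inl s /\ s c) ->
  forall s, S (inl s) -> s (pick S)).

Notation Rips := (rips_top d C r).
Notation Index := ((X -> Prop) + X)%type.
Notation coords := (coord X Index pick).
Notation coords_support L := (map pick (subsets Index L)).

Lemma region_in_cover (i : Index) : exists W, U W /\ forall y, region i y -> W y.
Proof.
  destruct i as [s | c]; cbn.
  - now exists (V s).
  - destruct (Hleb c) as [W [HW H]]. exists W. split; [exact HW|]. intros y Hy. apply H. lra.
Qed.

Lemma small_simplex (l : list X) (i : Index) : (forall x, In x l -> C x /\ region i x) -> NoDup l ->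
  rips_simplex d C r l.
Proof.
  intros H HN. split; [exact HN|]. split; [intros x Hx; now apply H|]. apply HUdiam.
  destruct (region_in_cover i) as [W [HW HiW]]. exists W. split; [exact HW|].
  intros x Hx. now apply HiW, H.
Qed.

(** An index [i0] of maximal weight lies in every active set, so all picked points lie in
    [region i0], hence in one member of the cover, hence span a simplex. The point [y] shows that
    the intersections to pick from are nonempty. *)
Lemma coords_carried (w : Index -> R) (L : list Index) (y : X) : supported w L ->
  (forall i, 0 <= w i) -> (exists i, 0 < w i) -> (forall i, 0 < w i -> region i y) ->
  carried X d C r (coords w).
Proof.
  intros Hs Hpos Hex Hy.
  assert (Hb : bounded Index w) by now apply supported_bounded with L.
  destruct (supf_attained Index w L Hs Hex) as [i0 [E0 H0]].
  assert (Hpk : forall c, 0 < coords w c -> C c /\ region i0 c).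
  { intros c Hc. destruct (coord_active X Index pick w c Hc) as [S [HS ->]].
    destruct (Hpick S L) as [H1 H2].
    - now apply active_supp with w.
    - exists y. intros i Hi. apply Hy. generalize (active_pos Index S w i HS Hi).
      unfold active in HS. lra.
    - split; [exact H1|]. apply H2. apply active_max with w; [exact HS|].
      intro i. rewrite E0. now apply supf_ge. }
  split; [intro c; now apply coord_nonneg|]. split.
  - exists (pick (fun i => 0 < w i)). apply active_coord; [exact Hb|]. now apply active_support with L.
  - exists (enum X (fun c => 0 < coords w c) (coords_support L)). split.
    + apply small_simplex with i0; [|apply enum_NoDup]. intros c Hc. apply enum_In in Hc. now apply Hpk.
    + apply supported_enum; auto.
      * intro c. now apply coord_nonneg.
      * now apply coord_supported.
Qed.

(** * The map from the space to the Rips complex, by tent functions on a finite net *)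

Definition net_weight (x : X) (i : Index) : R :=
  match i with
  | inl _ => 0
  | inr c => if excluded_middle_informative (In c E) then Rmax 0 (eta - d c x) else 0
  end.

Lemma net_weight_nonneg (x : X) (i : Index) : 0 <= net_weight x i.
Proof. destruct i as [s | c]; cbn; [lra|]. destruct excluded_middle_informative; [apply Rmax_l | lra]. Qed.

Lemma net_weight_supported (x : X) : supported (net_weight x) (map inr E).
Proof.
  intros i Hi. destruct i as [s | c]; cbn; [reflexivity|].
  destruct excluded_middle_informative as [H | H]; [|reflexivity]. exfalso. apply Hi. now apply in_map.
Qed.

Lemma net_weight_region (x : X) (i : Index) : 0 < net_weight x i -> exists c, i = inr c /\ d c x < eta.
Proof.
  destruct i as [s | c]; cbn; [lra|]. destruct excluded_middle_informative; [|lra].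
  intro H. exists c. split; [reflexivity|]. unfold Rmax in H. destruct Rle_dec in H; lra.
Qed.

Lemma net_weight_pos (x : X) : exists c, 0 < net_weight x (inr c).
Proof.
  destruct (HE x) as [c [Hc H]]. exists c. cbn. destruct excluded_middle_informative; [|contradiction].
  eapply Rlt_le_trans; [|apply Rmax_r]. lra.
Qed.

Lemma net_weight_lim (Z : Type) (F : (Z -> Prop) -> Prop) (y : Z -> X) (y0 : X) (i : Index) :
  is_filter Z F -> metric_lim X Z d F y y0 -> lim Z F (fun z => net_weight (y z) i) (net_weight y0 i).
Proof.
  intros HF Hy. destruct i as [s | c]; cbn; [now apply lim_const|].
  destruct excluded_middle_informative; [|now apply lim_const].
  apply lim_Rmax_l; [exact HF|]. apply lim_minus; [exact HF | now apply lim_const | now apply dist_lim].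
Qed.

Lemma net_carried (x : X) : carried X d C r (coords (net_weight x)).
Proof.
  apply coords_carried with (map inr E) x.
  - apply net_weight_supported.
  - apply net_weight_nonneg.
  - destruct (net_weight_pos x) as [c Hc]. now exists (inr c).
  - intros i Hi. destruct (net_weight_region x i Hi) as [c [-> Hc]]. exact Hc.
Qed.

Definition to_rips (x : X) : pt Rips := realize X d C r (coords (net_weight x)) (net_carried x).

Lemma to_rips_supported (x : X) : supported (proj1_sig (to_rips x)) (coords_support (map inr E)).
Proof.
  intros c Hc. cbn. unfold normalized.
  rewrite (coord_supported X Index pick _ _ (net_weight_supported x) c Hc). unfold Rdiv. ring.
Qed.

(** Both [x] and the picked vertex lie in a ball of radius [eta] about the same net point. *)
Lemma to_rips_near (x c : X) : 0 < proj1_sig (to_rips x) c -> d x c < 2 * eta.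
Proof.
  cbn. intro H. generalize (carried_total X d C r _ (net_carried x)). intro Ht.
  assert (Hc : 0 < coords (net_weight x) c).
  { apply Rnot_le_lt. intro N. unfold normalized, Rdiv in H.
    assert (0 < / total X (coords (net_weight x))) by now apply Rinv_0_lt_compat. nra. }
  destruct (coord_active X Index pick _ c Hc) as [S [HS ->]].
  destruct (active_inhabited Index S _ HS) as [i Hi].
  assert (Hall : forall j, S j -> exists c, j = inr c /\ d c x < eta).
  { intros j Hj. apply net_weight_region. generalize (active_pos Index S _ j HS Hj).
    unfold active in HS. lra. }
  destruct (Hpick S (map inr E)) as [_ Hp].
  - apply active_supp with (net_weight x); [apply net_weight_supported | exact HS].
  - exists x. intros j Hj. destruct (Hall j Hj) as [c' [-> Hc']]. exact Hc'.
  - destruct (Hall i Hi) as [c' [-> Hc']]. specialize (Hp _ Hi). cbn in Hp.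
    generalize (dist_tri X d Hd x c' (pick S)). rewrite (dist_sym X d Hd x c'). lra.
Qed.

Lemma to_rips_lim (Z : Type) (F : (Z -> Prop) -> Prop) (y : Z -> X) (y0 : X) (c : X) :
  is_filter Z F -> metric_lim X Z d F y y0 ->
  lim Z F (fun z => proj1_sig (to_rips (y z)) c) (proj1_sig (to_rips y0) c).
Proof.
  intros HF Hy. cbn. apply normalized_lim with (coords_support (map inr E)).
  - exact HF.
  - apply filt_all; [exact HF|]. intro z. apply coord_supported, net_weight_supported.
  - apply coord_supported, net_weight_supported.
  - apply carried_total with d C r, net_carried.
  - intro x. apply (coord_lim X Index pick Z F (fun z => net_weight (y z))); [exact HF | |].
    + apply supported_bounded with (map inr E), net_weight_supported.
    + apply unif_lim_finite with (map inr E); [exact HF | | apply net_weight_supported |].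
      * apply filt_all; [exact HF|]. intro z. apply net_weight_supported.
      * intro i. now apply net_weight_lim.
Qed.

Lemma to_rips_unif_lim (Z : Type) (F : (Z -> Prop) -> Prop) (y : Z -> X) (y0 : X) :
  is_filter Z F -> metric_lim X Z d F y y0 ->
  unif_lim Z X F (fun z => proj1_sig (to_rips (y z))) (proj1_sig (to_rips y0)).
Proof.
  intros HF Hy. apply unif_lim_finite with (coords_support (map inr E)).
  - exact HF.
  - apply filt_all; [exact HF|]. intro z. apply to_rips_supported.
  - apply to_rips_supported.
  - intro c. now apply to_rips_lim.
Qed.

Lemma to_rips_continuous : continuous (metric_top d) Rips to_rips.
Proof.
  apply continuous_from_metric. intros x W HW Hx.
  apply (rips_lim X d C r X (near X d x) (coords_support (map inr E)) to_rips (to_rips x)).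
  - apply near_filter.
  - apply filt_all; [apply near_filter|]. intro y. apply to_rips_supported.
  - apply to_rips_supported.
  - intro c. apply to_rips_lim; [apply near_filter | apply near_id].
  - exact HW.
  - exact Hx.
Qed.

(** * The map from the Rips complex to the space *)

Notation folding := (fold X (X -> Prop) K).
Notation weights p := (clip X (proj1_sig p)).

Lemma weights_supported (p : pt Rips) (l : list X) (L : list (X -> Prop)) : supported (proj1_sig p) l ->
  (forall s, active X (proj1_sig p) s -> In s L) -> supported (weights p) L.
Proof. apply clip_supported. Qed.

Lemma weights_nonneg (p : pt Rips) (s : X -> Prop) : 0 <= weights p s.
Proof. destruct (rips_pt_simplex X d C r p) as [l [_ Hs]]. now apply clip_nonneg with l. Qed.

Lemma weights_pos (p : pt Rips) : exists s, 0 < weights p s.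
Proof.
  destruct (rips_pt_simplex X d C r p) as [l [_ Hs]]. destruct (rips_pt_vertex X d C r p) as [v [Hv _]].
  apply clip_pos with l; [exact Hs | apply rips_pt_pos | now exists v].
Qed.

Lemma active_in_subsets (p : pt Rips) (l : list X) (s : X -> Prop) :
  supported (proj1_sig p) l -> active X (proj1_sig p) s -> In s (subsets X l).
Proof. intros Hs H. apply subsets_spec. now apply active_supp with (proj1_sig p). Qed.

Lemma active_in_V (p : pt Rips) (s : X -> Prop) (x : X) : active X (proj1_sig p) s -> s x -> V s x.
Proof.
  intros H Hx. destruct (rips_pt_simplex X d C r p) as [l [[_ [_ Hl]] Hs]].
  apply HVsimplex with l; [now apply active_supp with (proj1_sig p) | exact Hl | exact Hx].
Qed.

Lemma weights_max_gap_pos (p : pt Rips) : 0 < max_gap (X -> Prop) (weights p).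
Proof.
  destruct (rips_pt_simplex X d C r p) as [l [_ Hs]].
  assert (HL : supported (weights p) (subsets X l)).
  { apply weights_supported with l; [exact Hs|]. intro s. now apply active_in_subsets. }
  apply max_gap_pos with (subsets X l) (fun s => 0 < weights p s); [exact HL|].
  apply active_support with (subsets X l); [exact HL | apply weights_pos | apply weights_nonneg].
Qed.

Lemma folding_well_defined (p : pt Rips) (m n : nat) (x y : X) (L M : list (X -> Prop)) :
  supported (weights p) L -> supported (weights p) M -> (length L <= m)%nat -> (length M <= n)%nat ->
  (forall s, active X (proj1_sig p) s -> V s x) -> (forall s, active X (proj1_sig p) s -> V s y) ->
  folding (weights p) 1 m x = folding (weights p) 1 n y.
Proof.
  intros HL HM Hm Hn Hx Hy.
  assert (Hcard : forall L' k, supported (weights p) L' -> (length L' <= k)%nat ->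
    forall S j, active (X -> Prop) (weights p) S -> card (X -> Prop) S j -> (j <= k)%nat).
  { intros L' k HL' Hk S j HS [l [Hl [<- Hj]]]. apply Nat.le_trans with (2 := Hk).
    apply NoDup_incl_length; [exact Hl|]. intros s Hs. apply Hj in Hs.
    now apply active_supp with S (weights p). }
  set (N := Nat.max m n).
  rewrite <- (fold_bound X (X -> Prop) K (weights p) 1 m N x) by (try lia; now apply Hcard with L).
  rewrite <- (fold_bound X (X -> Prop) K (weights p) 1 n N y) by (try lia; now apply Hcard with M).
  (* [L] may list simplices whose cover sets miss the starting points, so it is cut down to the
     active ones. *)
  set (P := enum (X -> Prop) (active X (proj1_sig p)) L).
  assert (HP : supported (weights p) P).
  { apply supported_enum; [apply weights_nonneg | | exact HL]. intros s. apply clip_active. }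
  apply (fold_start X (X -> Prop) d V K HK P (weights p)).
  - exact HP.
  - destruct (time_attained (X -> Prop) L (weights p) HL (weights_nonneg p) (weights_pos p))
      as [S [k [H1 [H2 [H3 H4]]]]].
    exists S, k. repeat split; auto. lia.
  - apply pending_start. intros s Hs. apply enum_In in Hs. now apply Hx.
  - apply pending_start. intros s Hs. apply enum_In in Hs. now apply Hy.
Qed.

(** The value is tied to all admissible lengths, starting points and lists at once, leaving each
    later proof free to choose: a maximal vertex for continuity, the point [x] itself for the
    homotopy on [X]. *)
Lemma of_rips_exists (p : pt Rips) : exists z, forall n x L, supported (weights p) L -> (length L <= n)%nat ->
  (forall s, active X (proj1_sig p) s -> V s x) -> z = folding (weights p) 1 n x.
Proof.
  destruct (rips_pt_simplex X d C r p) as [l [_ Hs]].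
  destruct (rips_pt_vertex X d C r p) as [v [_ Hv]].
  exists (folding (weights p) 1 (length (subsets X l)) v). intros n x L HL Hn Hx.
  apply folding_well_defined with (subsets X l) L; auto.
  - apply weights_supported with l; [exact Hs|]. intro s. now apply active_in_subsets.
  - intros s H. apply active_in_V with p; [exact H|]. now apply active_max with (proj1_sig p).
Qed.

Definition of_rips (p : pt Rips) : X := proj1_sig (constructive_indefinite_description _ (of_rips_exists p)).

Lemma of_rips_eq (p : pt Rips) (n : nat) (x : X) (L : list (X -> Prop)) :
  supported (weights p) L -> (length L <= n)%nat ->
  (forall s, active X (proj1_sig p) s -> V s x) -> of_rips p = folding (weights p) 1 n x.
Proof. exact (proj2_sig (constructive_indefinite_description _ (of_rips_exists p)) n x L). Qed.

(** By the truncation such an [s] has maximal weight, so it belongs to every active set and the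
    folding never leaves [V s]. *)
Lemma of_rips_mem (p : pt Rips) (s : X -> Prop) : active X (proj1_sig p) s ->
  max_weight X (proj1_sig p) / 2 <= gap X (proj1_sig p) s -> V s (of_rips p).
Proof.
  intros Ha Hs. destruct (rips_pt_simplex X d C r p) as [l [_ Hl]].
  destruct (rips_pt_vertex X d C r p) as [v [_ Hv]].
  set (L := enum (X -> Prop) (active X (proj1_sig p)) (subsets X l)).
  assert (HL : supported (weights p) L).
  { apply weights_supported with l; [exact Hl|]. intros s' Hs'. apply enum_In. split; [|exact Hs'].
    now apply active_in_subsets with p. }
  assert (Hv' : forall s', active X (proj1_sig p) s' -> V s' v).
  { intros s' H. apply active_in_V with p; [exact H|]. now apply active_max with (proj1_sig p). }
  rewrite (of_rips_eq p (length L) v L HL (Nat.le_refl _) Hv').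
  apply (fold_mem X (X -> Prop) d V K HK L).
  - exact HL.
  - lra.
  - apply pending_start. intros s' Hs'. apply enum_In in Hs'. now apply Hv'.
  - apply enum_In. split; [now apply active_in_subsets with p | exact Ha].
  - intros S HS. apply active_max with (weights p); [exact HS|]. now apply clip_max.
Qed.

Lemma of_rips_lim (Z : Type) (F : (Z -> Prop) -> Prop) (p : Z -> pt Rips) (p0 : pt Rips) (l : list X) :
  is_filter Z F -> rips_simplex d C r l -> F (fun z => supported (proj1_sig (p z)) l) ->
  supported (proj1_sig p0) l -> unif_lim Z X F (fun z => proj1_sig (p z)) (proj1_sig p0) ->
  metric_lim X Z d F (fun z => of_rips (p z)) (of_rips p0).
Proof.
  intros HF Hl HFl H0 Hp e He.
  set (top := fun v z => forall x, proj1_sig (p z) x <= proj1_sig (p z) v).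
  (* on each of the finitely many closed pieces where a fixed vertex is maximal, start from it *)
  assert (Hpiece : F (fun z => forall v, In v l -> top v z -> d (of_rips p0) (of_rips (p z)) < e)).
  { apply filt_list; [exact HF|]. intros v Hv.
    destruct (classic (forall x, proj1_sig p0 x <= proj1_sig p0 v)) as [Hmax | N].
    (* The filter restricted to the piece where [v] is maximal. *)
    - set (G := fun P : Z -> Prop => F (fun z => top v z -> P z)).
      assert (HG : is_filter Z G).
      { split.
        - apply (filt_all Z F HF). auto.
        - intros P Q HP HQ. eapply (filt_imp _ _ HF). 2: exact (filt_and _ _ HF _ _ HP HQ). cbn. tauto.
        - intros P Q H HP. eapply (filt_imp _ _ HF). 2: exact HP. cbn. auto. }
      assert (HFG : forall P : Z -> Prop, F P -> G P).
      { intros P HP. eapply (filt_imp _ _ HF). 2: exact HP. cbn. auto. }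
      assert (Htop : G (top v)) by (apply (filt_all Z F HF); auto).
      (* On this piece every active simplex contains [v], so [v] is an admissible start throughout
         and the starting point is constant. *)
      set (L := enum (X -> Prop) (fun s => s v) (subsets X l)).
      assert (HL : forall q : pt Rips, supported (proj1_sig q) l ->
        (forall x, proj1_sig q x <= proj1_sig q v) -> supported (weights q) L).
      { intros q Hq Hm. apply weights_supported with l; [exact Hq|]. intros s Hs. apply enum_In.
        split; [now apply active_in_subsets with q | now apply active_max with (proj1_sig q)]. }
      assert (HLv : forall s, In s L -> V s v).
      { intros s Hs. apply enum_In in Hs. apply HVsimplex with l; [|apply Hl | apply Hs].
        apply subsets_spec. apply Hs. }
      assert (Heq : forall q : pt Rips, supported (proj1_sig q) l ->
        (forall x, proj1_sig q x <= proj1_sig q v) -> of_rips q = folding (weights q) 1 (length L) v).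
      { intros q Hq Hm. apply of_rips_eq with L; [now apply HL | lia|].
        intros s Hs. apply active_in_V with q; [exact Hs|]. now apply active_max with (proj1_sig q). }
      rewrite (Heq p0 H0 Hmax).
      assert (Hlim : metric_lim X Z d G (fun z => folding (weights (p z)) 1 (length L) v)
                       (folding (weights p0) 1 (length L) v)).
      { apply (fold_lim X (X -> Prop) d V K HK Z G HG L (fun z => weights (p z)) (weights p0) (fun _ => 1) 1).
        - apply clip_lim with l; auto. intros e' He'. apply HFG, Hp, He'.
        - eapply (filt_imp _ _ HG). 2: exact (filt_and _ _ HG _ _ Htop (HFG _ HFl)).
          cbn. intros z [H1 H2]. now apply HL.
        - now apply HL.
        - apply weights_max_gap_pos.
        - now apply lim_const.
        - apply filt_all; [exact HG|]. intro; lra.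
        - lra.
        - intros e' He'. apply filt_all; [exact HG|]. intro. now rewrite dist_self.
        - apply filt_all; [exact HG|]. intro. now apply pending_start.
        - now apply pending_start. }
      specialize (Hlim e He). eapply (filt_imp _ _ HF). 2: exact (filt_and _ _ HF _ _ HFl Hlim).
      cbn. intros z [H1 H2] Ht. rewrite (Heq (p z) H1 Ht). auto.
    - apply not_all_ex_not in N. destruct N as [x Hx].
      assert (Hgt : F (fun z => 0 < proj1_sig (p z) x - proj1_sig (p z) v)).
      { apply (lim_gt Z F HF _ (proj1_sig p0 x - proj1_sig p0 v)); [lra|].
        apply lim_minus; [exact HF | |];
          now apply (unif_lim_at Z F HF X (fun z => proj1_sig (p z))). }
      eapply (filt_imp _ _ HF). 2: exact Hgt. cbn. intros z H1 H2. specialize (H2 x). lra. }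
  eapply (filt_imp _ _ HF). 2: exact (filt_and _ _ HF _ _ HFl Hpiece).
  cbn. intros z [H1 H2]. destruct (rips_pt_vertex X d C r (p z)) as [v [Hv Hm]].
  apply (H2 v); [now apply supported_In with (proj1_sig (p z)) | exact Hm].
Qed.

Lemma of_rips_continuous : continuous Rips (metric_top d) of_rips.
Proof.
  apply continuous_from_rips. intros l p W Hl Hp HW HWp.
  destruct (HW _ HWp) as [e [He H]].
  eapply (filt_imp _ _ (simplex_nbhd_filter X d C r l p)).
  2: exact (of_rips_lim (pt Rips) (simplex_nbhd X d C r l p) (fun q => q) p l
    (simplex_nbhd_filter X d C r l p) Hl (simplex_nbhd_supported X d C r l p) Hp
    (simplex_nbhd_lim X d C r l p Hp) e He).
  cbn. intros q Hq. now apply H.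
Qed.

(** * The homotopies *)

Lemma active_near_net (x y : X) (s : X -> Prop) :
  active X (proj1_sig (to_rips x)) s -> d x y < eta -> V s y.
Proof.
  intros Hs Hy. apply HVsmall with x; [now apply active_inhabited with (proj1_sig (to_rips x)) | | exact Hy].
  intros c Hc. apply to_rips_near. generalize (active_pos X s _ c Hs Hc). unfold active in Hs. lra.
Qed.

Lemma of_rips_to_rips_homotopic :
  homotopic (metric_top d) (metric_top d) (fun x => of_rips (to_rips x)) (fun x => x).
Proof.
  set (F0 := subsets X (coords_support (map inr E))).
  assert (HF0 : forall x s, active X (proj1_sig (to_rips x)) s -> In s F0).
  { intros x s Hs. apply active_in_subsets with (to_rips x); [apply to_rips_supported | exact Hs]. }
  set (H := fun z : X * I01 =>
    folding (weights (to_rips (fst z))) (1 - proj1_sig (snd z)) (length F0) (fst z)).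
  exists H. split.
  - apply (continuous_from_metric_I X d Hd). intros x s W HW HWx.
    set (N := with_time X (near X d x) s).
    assert (HN : is_filter _ N) by apply with_time_filter, near_filter.
    (* For [y] near [x] every active simplex of [to_rips y] also has [x] in its cover set, so this
       list serves a whole neighbourhood; as the cover sets are open, nearby points are admissible
       starts for it. *)
    set (L := enum (X -> Prop) (fun s => V s x) F0).
    assert (HL : forall y, d x y < eta -> supported (weights (to_rips y)) L).
    { intros y Hy. apply weights_supported with (coords_support (map inr E)); [apply to_rips_supported|].
      intros s' Hs'. apply enum_In. split; [now apply HF0 with y|].
      apply active_near_net with y; [exact Hs'|]. now rewrite dist_sym. }
    assert (Hfst : metric_lim X _ d N (fun z => fst z) x).
    { intros e He. apply with_time_fst with (P := fun y => d x y < e); [apply near_filter|].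
      now exists e. }
    assert (Hlim : metric_lim X _ d N H (H (x, s))).
    { unfold H. cbn [fst snd].
      apply (fold_lim X (X -> Prop) d V K HK _ N HN L (fun z => weights (to_rips (fst z)))).
      - apply clip_lim with (coords_support (map inr E)).
        + exact HN.
        + apply filt_all; [exact HN|]. intro. apply to_rips_supported.
        + apply to_rips_supported.
        + now apply (to_rips_unif_lim _ N (fun z => fst z)).
      - eapply (filt_imp _ _ HN). 2: exact (Hfst eta Heta). cbn. intros z Hz. now apply HL.
      - apply HL. now rewrite dist_self.
      - apply weights_max_gap_pos.
      - apply lim_minus; [exact HN | now apply lim_const|]. apply with_time_snd, near_filter.
      - apply filt_all; [exact HN|]. intro z. destruct (proj2_sig (snd z)). lra.
      - destruct (proj2_sig s). lra.
      - exact Hfst.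
      - apply (filt_imp _ _ HN (fun z => forall s', In s' L -> V s' (fst z))).
        { intros z Hz. now apply pending_start. }
        apply (filt_list _ N HN (X -> Prop) L (fun s' z => V s' (fst z))). intros s' Hs'.
        apply with_time_fst with (P := V s'); [apply near_filter|].
        apply HUopen; [apply HVU|]. apply enum_In in Hs'. apply Hs'.
      - apply pending_start. intros s' Hs'. apply enum_In in Hs'. apply Hs'. }
    destruct (HW _ HWx) as [e [He HWe]].
    eapply (filt_imp _ _ HN). 2: exact (Hlim e He). cbn. intros z Hz. now apply HWe.
  - intro x. unfold H. cbn [fst snd proj1_sig I0 I1].
    assert (HL : supported (weights (to_rips x)) F0).
    { apply weights_supported with (coords_support (map inr E)); [apply to_rips_supported | apply HF0]. }
    assert (Hx : forall s, active X (proj1_sig (to_rips x)) s -> V s x).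
    { intros s Hs. apply active_near_net with x; [exact Hs|]. now rewrite dist_self. }
    split.
    + rewrite Rminus_0_r. symmetry. now apply of_rips_eq with F0.
    + rewrite Rminus_diag. set (P := enum (X -> Prop) (active X (proj1_sig (to_rips x))) F0).
      apply (fold_0 X (X -> Prop) d V K HK P).
      * apply supported_enum; [apply weights_nonneg | | exact HL]. intros s. apply clip_active.
      * apply pending_start. intros s Hs. apply enum_In in Hs. now apply Hx.
Qed.

(* Moves from the subdivision weights of [p] to the net weights of [of_rips p].  The latter are
   turned on only for [k > 1/2], when the former are supported on indices of weight at least half
   the maximum, whose regions contain [of_rips p]. *)
Definition blend (p : pt Rips) (k : R) (i : Index) : R :=
  match i with
  | inl s => (1 - k) * Rmax 0 (gap X (proj1_sig p) s - k * max_weight X (proj1_sig p))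
  | inr c => Rmax 0 (2 * k - 1) * net_weight (of_rips p) (inr c)
  end.

Definition blend_support (l : list X) : list Index := map inl (subsets X l) ++ map inr E.

Lemma blend_supported (p : pt Rips) (k : R) (l : list X) :
  supported (proj1_sig p) l -> 0 <= k -> supported (blend p k) (blend_support l).
Proof.
  intros Hs Hk [s | c] Hi; cbn.
  - rewrite (gap_supported X _ l Hs).
    + generalize (max_weight_nonneg X _ l Hs). intro. rewrite Rmax_left by nra. ring.
    + intro N. apply Hi, in_or_app. left. now apply in_map.
  - destruct excluded_middle_informative; [|ring]. exfalso. apply Hi, in_or_app. right. now apply in_map.
Qed.

Lemma blend_nonneg (p : pt Rips) (k : R) (i : Index) : 0 <= k <= 1 -> 0 <= blend p k i.
Proof.
  intro Hk. destruct i as [s | c]; unfold blend.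
  - apply Rmult_le_pos; [lra | apply Rmax_l].
  - apply Rmult_le_pos; [apply Rmax_l | apply net_weight_nonneg].
Qed.

Lemma Rmax_0_pos (x : R) : 0 < Rmax 0 x -> 0 < x.
Proof. unfold Rmax. destruct Rle_dec; lra. Qed.

Lemma blend_inl_pos (p : pt Rips) (k : R) (s : X -> Prop) : 0 <= k <= 1 -> 0 < blend p k (inl s) ->
  k * max_weight X (proj1_sig p) < gap X (proj1_sig p) s /\ active X (proj1_sig p) s.
Proof.
  intros Hk H. cbn in H. destruct (rips_pt_simplex X d C r p) as [l [_ Hs]].
  generalize (max_weight_nonneg X _ l Hs). intro Hm.
  set (q := gap X (proj1_sig p) s - k * max_weight X (proj1_sig p)) in *.
  assert (Hq : 0 < q).
  { apply Rmax_0_pos. generalize (Rmax_l 0 q). intro. destruct (Rle_dec (Rmax 0 q) 0); [nra | lra]. }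
  unfold q in Hq. unfold active. split; nra.
Qed.

Lemma blend_inr_pos (p : pt Rips) (k : R) (c : X) : 0 < blend p k (inr c) ->
  1 / 2 < k /\ 0 < net_weight (of_rips p) (inr c).
Proof.
  unfold blend. intro H. generalize (Rmax_l 0 (2 * k - 1)) (net_weight_nonneg (of_rips p) (inr c)). intros H1 H2.
  split; [|nra]. assert (0 < 2 * k - 1); [|lra]. apply Rmax_0_pos. nra.
Qed.

(** The regions in use need a common point. Up to [k = 1/2] only simplices occur, and the maximal
    vertex of [p] lies in all their cover sets. Afterwards only simplices with more than half the
    maximal gap remain, whose cover sets contain [of_rips p], as do the balls of the net weights. *)
Lemma blend_carried (p : pt Rips) (k : R) : 0 <= k <= 1 -> carried X d C r (coords (blend p k)).
Proof.
  intro Hk. destruct (rips_pt_simplex X d C r p) as [l [_ Hs]].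
  destruct (rips_pt_vertex X d C r p) as [v [Hv0 Hv]].
  apply coords_carried with (blend_support l) (if Rle_dec k (1 / 2) then v else of_rips p).
  - apply blend_supported; [exact Hs | lra].
  - intro i. now apply blend_nonneg.
  - destruct (Req_dec k 1) as [-> | Hne].
    + destruct (net_weight_pos (of_rips p)) as [c Hc]. exists (inr c). unfold blend.
      rewrite Rmax_right by lra. lra.
    (* A simplex of maximal gap keeps positive weight for all [k < 1]. *)
    + destruct (max_weight_attained X _ l Hs (rips_pt_pos X d C r p)) as [s [Hs1 Hs2]]; [now exists v|].
      exists (inl s). cbn. rewrite <- Hs1. apply Rmult_lt_0_compat; [lra|].
      eapply Rlt_le_trans; [|apply Rmax_r]. nra.
  - intros [s | c] Hi.
    + destruct (blend_inl_pos p k s Hk Hi) as [H1 H2]. cbn. destruct Rle_dec as [Hk2 | Hk2].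
      * apply active_in_V with p; [exact H2|]. now apply active_max with (proj1_sig p).
      * apply of_rips_mem; [exact H2|]. generalize (max_weight_nonneg X _ l Hs). nra.
    + destruct (blend_inr_pos p k c Hi) as [H1 H2]. destruct Rle_dec as [Hk2 | Hk2]; [lra|].
      destruct (net_weight_region _ _ H2) as [c' [Ec Hc']]. injection Ec as ->. exact Hc'.
Qed.

(** At [k = 0] all indices are active simplices of [p], which share its maximal vertex; so the
    picked point is a vertex of [p]. This makes the straight segment to the blend legitimate. *)
Lemma blend_0_face (p : pt Rips) (c : X) : 0 < coords (blend p 0) c -> 0 < proj1_sig p c.
Proof.
  intro H. destruct (coord_active X Index pick _ c H) as [S [HS ->]].
  destruct (rips_pt_vertex X d C r p) as [v [Hv0 Hv]].
  destruct (rips_pt_simplex X d C r p) as [l [[_ [HC _]] Hl]].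
  assert (Hall : forall i, S i -> exists s, i = inl s /\ active X (proj1_sig p) s).
  { intros i Hi. generalize (active_pos Index S _ i HS Hi). unfold active in HS. intro Hp.
    destruct i as [s | c].
    - exists s. split; [reflexivity|]. apply (blend_inl_pos p 0 s); lra.
    - destruct (blend_inr_pos p 0 c); lra. }
  destruct (active_inhabited Index S _ HS) as [i Hi]. destruct (Hall i Hi) as [s [-> Hs]].
  assert (Hc : s (pick S)).
  { apply Hpick_common; [|exact Hi]. exists v. split.
    - apply HC. now apply supported_In with (proj1_sig p).
    - intros j Hj. destruct (Hall j Hj) as [s' [-> Hs']].
      assert (Hsv : s' v) by now apply active_max with (proj1_sig p).
      split; [now apply active_in_V with p | now exists s']. }
  generalize (active_pos X s _ _ Hs Hc). unfold active in Hs. lra.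
Qed.

Lemma blend_lim (Z : Type) (F : (Z -> Prop) -> Prop) (p : Z -> pt Rips) (p0 : pt Rips)
    (k : Z -> R) (k0 : R) (l : list X) :
  is_filter Z F -> rips_simplex d C r l -> F (fun z => supported (proj1_sig (p z)) l) ->
  supported (proj1_sig p0) l -> unif_lim Z X F (fun z => proj1_sig (p z)) (proj1_sig p0) ->
  lim Z F k k0 -> F (fun z => 0 <= k z) -> 0 <= k0 ->
  unif_lim Z Index F (fun z => blend (p z) (k z)) (blend p0 k0).
Proof.
  intros HF Hl HFl H0 Hp Hk HFk Hk0.
  apply unif_lim_finite with (blend_support l).
  - exact HF.
  - eapply (filt_imp _ _ HF). 2: exact (filt_and _ _ HF _ _ HFl HFk). cbn. intros z [H1 H2].
    now apply blend_supported.
  - now apply blend_supported.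
  - intros [s | c]; unfold blend.
    + apply lim_mult; [exact HF | |].
      * apply lim_minus; [exact HF | now apply lim_const | exact Hk].
      * apply lim_Rmax_l; [exact HF|]. apply lim_minus; [exact HF | |].
        -- now apply (gap_lim_at X Z F (fun z => proj1_sig (p z))).
        -- apply lim_mult; [exact HF | exact Hk|].
           apply (max_weight_lim X Z F (fun z => proj1_sig (p z))); [exact HF | | exact Hp].
           now apply supported_bounded with l.
    + apply lim_mult; [exact HF | |].
      * apply lim_Rmax_l; [exact HF|]. apply lim_minus; [exact HF | | now apply lim_const].
        apply lim_mult; [exact HF | now apply lim_const | exact Hk].
      * apply net_weight_lim; [exact HF|]. now apply of_rips_lim with l.
Qed.

(** Stays 0 while [p] still contributes to the path, up to [s = 1/3], and reaches 1 at [s = 1]. *)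
Definition phase (s : R) : R := Rmax 0 ((3 * s - 1) / 2).

Lemma phase_range (s : R) : s <= 1 -> 0 <= phase s <= 1.
Proof. intro Hs. split; [apply Rmax_l | apply Rmax_lub; lra]. Qed.

(* For [s < 1/3] a combination of [p] with a point of the same simplex, afterwards the blend. *)
Definition path (p : pt Rips) (s : R) (x : X) : R :=
  Rmax 0 (1 / 3 - s) * proj1_sig p x + s * coords (blend p (phase s)) x.

Lemma coords_blend_nonneg (p : pt Rips) (s : R) (x : X) : s <= 1 -> 0 <= coords (blend p (phase s)) x.
Proof. intro Hs. destruct (blend_carried p (phase s) (phase_range s Hs)) as [H _]. apply H. Qed.

Lemma path_carried (p : pt Rips) (s : R) : 0 <= s <= 1 -> carried X d C r (path p s).
Proof.
  intro Hs. destruct (rips_pt_simplex X d C r p) as [l [Hl Hpl]].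
  destruct (rips_pt_vertex X d C r p) as [v [Hv0 Hv]].
  assert (Hpos : forall x, 0 <= coords (blend p (phase s)) x) by (intro; apply coords_blend_nonneg; lra).
  assert (Hpp : forall x, 0 <= proj1_sig p x) by apply rips_pt_pos.
  split.
  { intro x. apply Rplus_le_le_0_compat; apply Rmult_le_pos; auto; [apply Rmax_l | lra]. }
  destruct (Rlt_dec s (1 / 3)) as [Hs3 | Hs3].
  - split.
    + exists v. unfold path. apply Rplus_lt_le_0_compat.
      * apply Rmult_lt_0_compat; [|exact Hv0]. rewrite Rmax_right; lra.
      * apply Rmult_le_pos; [lra | auto].
    + exists l. split; [exact Hl|]. intros x Hx. unfold path. rewrite (Hpl x Hx).
      replace (coords (blend p (phase s)) x) with 0; [ring|].
      apply Rle_antisym; [apply Hpos|]. apply Rnot_lt_le. intro H.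
      replace (phase s) with 0 in H by (unfold phase; rewrite Rmax_left; lra).
      apply blend_0_face in H. rewrite (Hpl x Hx) in H. lra.
  (* From 1/3 on [p] has weight 0, so the carrying simplex may change. *)
  - destruct (blend_carried p (phase s)) as [_ [[x Hx] [l' [Hl' Hs']]]]; [apply phase_range; lra|].
    assert (Epath : forall y, path p s y = s * coords (blend p (phase s)) y).
    { intro y. unfold path. rewrite Rmax_left by lra. ring. }
    split.
    + exists x. rewrite Epath. apply Rmult_lt_0_compat; lra.
    + exists l'. split; [exact Hl'|]. intros y Hy. rewrite Epath, (Hs' y Hy). ring.
Qed.

Lemma reversed_range (s : I01) : 0 <= 1 - proj1_sig s <= 1.
Proof. destruct s as [s Hs]. cbn. lra. Qed.

Lemma to_rips_of_rips_homotopic : homotopic Rips Rips (fun p => to_rips (of_rips p)) (fun p => p).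
Proof.
  set (H := fun z : pt Rips * I01 =>
    realize X d C r (path (fst z) (1 - proj1_sig (snd z))) (path_carried (fst z) _ (reversed_range (snd z)))).
  exists H. split.
  - apply continuous_from_rips_I. intros l p s W Hl Hp HW HWp.
    set (N := with_time (pt Rips) (simplex_nbhd X d C r l p) s).
    assert (HN : is_filter _ N) by apply with_time_filter, simplex_nbhd_filter.
    (* In general no simplex, but a finite set of vertices containing all supports near [(p, s)], as
       [rips_lim] requires. *)
    set (L := l ++ coords_support (blend_support l)).
    assert (HL : forall q t, t <= 1 -> supported (proj1_sig q) l -> supported (path q t) L).
    { intros q t Ht Hq x Hx. unfold path. rewrite Hq.
      - rewrite (coord_supported X Index pick (blend q (phase t)) (blend_support l)); [ring | |].
        + apply blend_supported; [exact Hq | now apply phase_range].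
        + intro Hx'. apply Hx, in_or_app. now right.
      - intro Hx'. apply Hx, in_or_app. now left. }
    assert (HNl : N (fun z => supported (proj1_sig (fst z)) l)).
    { apply with_time_fst with (P := fun q : pt Rips => supported (proj1_sig q) l);
        [apply simplex_nbhd_filter | apply simplex_nbhd_supported]. }
    assert (HNp : unif_lim _ X N (fun z => proj1_sig (fst z)) (proj1_sig p)).
    { intros e He.
      apply with_time_fst with (P := fun q : pt Rips => forall x, Rabs (proj1_sig q x - proj1_sig p x) <= e);
        [apply simplex_nbhd_filter | now apply (simplex_nbhd_lim X d C r l p Hp)]. }
    assert (HNs : lim _ N (fun z => 1 - proj1_sig (snd z)) (1 - proj1_sig s)).
    { apply lim_minus; [exact HN | now apply lim_const|]. apply with_time_snd, simplex_nbhd_filter. }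
    assert (HNpath : N (fun z => supported (path (fst z) (1 - proj1_sig (snd z))) L)).
    { eapply (filt_imp _ _ HN). 2: exact HNl. cbn. intros z Hz. apply HL; [|exact Hz]. apply reversed_range. }
    assert (Hpath : supported (path p (1 - proj1_sig s)) L) by (apply HL; [apply reversed_range | exact Hp]).
    assert (Hnorm : forall u, supported u L -> supported (normalized X u) L).
    { intros u Hu x Hx. unfold normalized, Rdiv. rewrite (Hu x Hx). ring. }
    apply (rips_lim X d C r _ N L H (H (p, s)) W).
    + exact HN.
    + eapply (filt_imp _ _ HN). 2: exact HNpath. cbn. intros z Hz. now apply Hnorm.
    + now apply Hnorm.
    + intro x. unfold H. cbn [realize proj1_sig fst snd].
      apply (normalized_lim X _ N L (fun z => path (fst z) (1 - proj1_sig (snd z)))).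
      * exact HN.
      * exact HNpath.
      * exact Hpath.
      * apply carried_total with d C r, path_carried, reversed_range.
      * intro y. unfold path. apply lim_plus; [exact HN | |]; apply lim_mult; try exact HN.
        -- apply lim_Rmax_l; [exact HN|]. apply lim_minus; [exact HN | now apply lim_const | exact HNs].
        -- now apply (unif_lim_at _ N HN X (fun z => proj1_sig (fst z))).
        -- exact HNs.
        -- apply (coord_lim X Index pick _ N (fun z => blend (fst z) (phase (1 - proj1_sig (snd z))))).
           ++ exact HN.
           ++ apply supported_bounded with (blend_support l), blend_supported; [exact Hp|].
              apply phase_range, reversed_range.
           ++ apply (blend_lim _ N (fun z => fst z) p (fun z => phase (1 - proj1_sig (snd z)))) with l; auto.
              ** apply lim_Rmax_l; [exact HN|]. unfold Rdiv.
                 apply lim_mult; [exact HN | | now apply lim_const].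
                 apply lim_minus; [exact HN | | now apply lim_const].
                 apply lim_mult; [exact HN | now apply lim_const | exact HNs].
              ** apply filt_all; [exact HN|]. intro z. apply Rmax_l.
              ** apply Rmax_l.
    + exact HW.
    + exact HWp.
  - intro p. unfold H. cbn [fst snd]. split.
    + apply realize_ext. intro x. unfold path. cbn [proj1_sig I0]. rewrite Rminus_0_r.
      rewrite Rmax_left by lra. replace (phase 1) with 1 by (unfold phase; rewrite Rmax_right; lra).
      replace (blend p 1) with (net_weight (of_rips p)); [ring|].
      apply functional_extensionality. intros [s | c]; unfold blend.
      * cbn [net_weight]. ring.
      * rewrite Rmax_right by lra. ring.
    + apply realize_scaled with (1 / 3); [lra|]. intro x. unfold path. cbn [proj1_sig I1].
      rewrite Rminus_diag, Rminus_0_r, Rmax_right by lra. ring.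
Qed.

Lemma rips_homotopy_equivalent : homotopy_equivalent Rips (metric_top d).
Proof.
  exists of_rips, to_rips. repeat split.
  - apply of_rips_continuous.
  - apply to_rips_continuous.
  - apply to_rips_of_rips_homotopic.
  - apply of_rips_to_rips_homotopic.
Qed.

End Maps.

(** * The empty case, the choices, and the theorem *)

Lemma empty_homotopy_equivalent (X : Type) (d : X -> X -> R) (C : X -> Prop) (r : R) :
  (X -> False) -> homotopy_equivalent (rips_top d C r) (metric_top d).
Proof.
  intro HX.
  assert (HR : pt (rips_top d C r) -> False).
  { intro p. destruct (rips_pt_vertex X d C r p) as [v _]. exact (HX v). }
  exists (fun p => False_rect _ (HR p)), (fun x => False_rect _ (HX x)). repeat split.
  - intros V _ l _ p. destruct (HR p).
  - intros V _ x. destruct (HX x).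
  - exists fst. split; [|intro p; destruct (HR p)].
    intros V _ [p s]. destruct (HR p).
  - exists fst. split; [|intro x; destruct (HX x)].
    intros V _ [x s]. destruct (HX x).
Qed.

Theorem mainTheorem15 (X : Type) (d : X -> X -> R) (r : R) (U : (X -> Prop) -> Prop) :
  is_metric d -> compact_metric d -> 0 < r ->
  open_cover d U -> good_cover d U ->
  (forall sigma : list X,
     (exists V, U V /\ forall x, In x sigma -> V x) <-> diam_lt d sigma r) ->
  exists C : X -> Prop, countable C /\
    homotopy_equivalent (rips_top d C r) (metric_top d).
Proof.
  intros Hd Hc _ HU Hgood HUdiam.
  destruct (countable_dense X d Hd Hc) as [C [HCc HCd]].
  exists C. split; [exact HCc|].
  (* The point [x0] provides defaults: a member of the cover and a value for [pick]. *)
  destruct (classic (inhabited X)) as [[x0] | HX].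
  2: { apply empty_homotopy_equivalent. intro x. now apply HX. }
  destruct (lebesgue_number X d Hd U Hc HU) as [e [He Hleb]].
  (* 6 = 2 + 4: the ball of radius [6 * eta] about [x] contains the [4 * eta] neighbourhood of every
     set within [2 * eta] of [x]. *)
  set (eta := e / 6). assert (Heta : 0 < eta) by (unfold eta; lra).
  assert (Hleb' : forall x, exists V, U V /\ forall y, d x y < 6 * eta -> V y).
  { intro x. replace (6 * eta) with e by (unfold eta; field). apply Hleb. }
  destruct (finite_net X d Hd C eta Hc Heta) as [E [_ HE]].
  { intro x. destruct (HCd x eta Heta) as [c [H1 H2]]. exists c. split; [exact H1|].
    now rewrite (dist_sym X d Hd). }
  assert (HV : forall s : X -> Prop, exists W, U W /\
    (forall l, (forall x, s x -> In x l) -> diam_lt d l r -> forall x, s x -> W x) /\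
    (forall x y, (exists c, s c) -> (forall c, s c -> d x c < 2 * eta) -> d x y < eta -> W y)).
  { intro s.
    (* A cover set containing a whole neighbourhood of [s] meets both demands. If there is none, no
       [x] is within [2 * eta] of all of [s], and the second demand is void. *)
    destruct (classic (exists W, U W /\ forall c, s c -> forall y, d c y < 4 * eta -> W y))
      as [[W [HW H]] | NA].
    { exists W. split; [exact HW|]. split.
      - intros l _ _ x Hx. apply (H x Hx). rewrite (dist_self X d Hd). lra.
      - intros x y [c Hc'] Hs Hy. apply (H c Hc'). specialize (Hs c Hc').
        generalize (dist_tri X d Hd c x y). rewrite (dist_sym X d Hd c x). lra. }
    assert (Hfar : forall W : X -> Prop, forall x y, (exists c, s c) ->
      (forall c, s c -> d x c < 2 * eta) -> d x y < eta -> W y).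
    { intros W x y _ Hs _. exfalso. apply NA. destruct (Hleb' x) as [W' [HW' H]].
      exists W'. split; [exact HW'|]. intros c Hc' z Hz. apply H. specialize (Hs c Hc').
      generalize (dist_tri X d Hd x c z). lra. }
    (* Now containing [s] suffices; if no member does, [s] lies in no finite set of diameter less
       than [r], and any member will do. *)
    destruct (classic (exists W, U W /\ forall x, s x -> W x)) as [[W [HW H]] | NB].
    { exists W. split; [exact HW|]. split; [intros l _ _; exact H | apply Hfar]. }
    destruct (Hleb' x0) as [W [HW _]]. exists W. split; [exact HW|]. split; [|apply Hfar].
    intros l Hl Hdl. exfalso. apply NB. apply HUdiam in Hdl. destruct Hdl as [W' [HW' H]].
    exists W'. auto. }
  apply choice_function in HV. destruct HV as [V HV].
  (* The contraction is chosen before the list [l], so that it depends on the set [S] only. *)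
  assert (HK : forall S, exists h, forall l, (forall s, S s -> In s l) -> (exists s, S s) ->
    (exists x, meet X (X -> Prop) V S x) -> contraction X d (meet X (X -> Prop) V S) h).
  { intro S. destruct (classic ((exists l, forall s, S s -> In s l) /\ (exists s, S s) /\
      exists x, meet X (X -> Prop) V S x)) as [[[l Hl] [[s Hs] [x Hx]]] | N].
    - set (m := map V (enum (X -> Prop) S l)).
      assert (Em : inter_list m = meet X (X -> Prop) V S).
      { apply pred_ext. intro y. unfold inter_list, m. split.
        - intros H s' Hs'. apply H, in_map, enum_In. auto.
        - intros H W HW. apply in_map_iff in HW. destruct HW as [s' [<- Hs']].
          apply enum_In in Hs'. now apply H. }
      assert (Hin : In (V s) m) by (apply in_map, enum_In; auto).
      destruct (Hgood m) as [H | H].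
      + intro Emp. now rewrite Emp in Hin.
      + apply Forall_forall. intros W HW. apply in_map_iff in HW. destruct HW as [s' [<- _]]. apply HV.
      + exfalso. apply (H x). now rewrite Em.
      + rewrite Em in H. destruct (contractible_contraction X d Hd _ H) as [h Hh]. now exists h.
    - exists (fun x _ => x). intros l Hl Hs Hx. exfalso. apply N. split; [now exists l | auto]. }
  apply choice_function in HK. destruct HK as [K HK].
  assert (Hpick : forall S : (X -> Prop) + X -> Prop, exists c,
    (forall l, (forall i, S i -> In i l) -> (exists y, forall i, S i -> region X d eta V i y) ->
       C c /\ forall i, S i -> region X d eta V i c) /\
    ((exists c, C c /\ forall i, S i -> region X d eta V i c /\ exists s, i = inl s /\ s c) ->
       forall s, S (inl s) -> s c)).
  { intro S.
    (* A common vertex takes precedence over an arbitrary point of [C] in the intersection, so a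
       single point meets both demands. *)
    destruct (classic (exists c, C c /\ forall i, S i -> region X d eta V i c /\ exists s, i = inl s /\ s c))
      as [[c [HCc' H]] | NA].
    { exists c. split.
      - intros l _ _. split; [exact HCc'|]. intros i Hi. now apply H.
      - intros _ s Hs. destruct (H _ Hs) as [_ [s' [Es Hs']]]. injection Es as ->. exact Hs'. }
    destruct (classic (exists c, C c /\ forall i, S i -> region X d eta V i c)) as [[c H] | NB].
    { exists c. split; [auto | contradiction]. }
    exists x0. split; [|contradiction]. intros l Hl [y Hy]. exfalso. apply NB.
    (* A finite intersection of open regions is open, so a nonempty one meets the dense set [C]. *)
    destruct (open_list X d (map (region X d eta V) (enum _ S l)) y) as [e1 [He1 H]].
    - intros W HW. apply in_map_iff in HW. destruct HW as [[s | c] [<- _]].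
      + apply HU, HV.
      + apply (ball_open X d Hd).
    - intros W HW. apply in_map_iff in HW. destruct HW as [i [<- Hi]]. apply enum_In in Hi. now apply Hy.
    - destruct (HCd y e1 He1) as [c [H1 H2]]. exists c. split; [exact H1|]. intros i Hi.
      apply (H c H2), in_map, enum_In. auto. }
  apply choice_function in Hpick. destruct Hpick as [pick Hpick].
  apply (rips_homotopy_equivalent X d Hd r U (proj1 HU) (fun l => proj1 (HUdiam l)) C eta Heta Hleb' E HE
    V (fun s => proj1 (HV s)) (fun s => proj1 (proj2 (HV s))) (fun s => proj2 (proj2 (HV s)))
    K HK pick (fun S => proj1 (Hpick S)) (fun S => proj2 (Hpick S))).
Qed.
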